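(* Let $d\ge 2$ and let $r=r(n)\in[r_{\min},r_{\max}]$ where $r_g<r_{\min}\le r_{\max}$ are constants. For each $n\ge 4$ let $B_1,\dots,B_{2^dn}$ be axis-parallel cubes of side length $(\log n)^{2/d}$ covering $\Lambda_n^{(d)}$. Then with high probability as $n\to\infty$, for every $i$, the sum of the degrees (in $G$) of the vertices of $G$ lying in $B_i$ is less than $2\gamma_d r^d(\log n)^2$.
   Context: $\Lambda_n^{(d)}$ is the torus $\left[-\frac{n^{1/d}}{2},\frac{n^{1/d}}{2}\right]^d$ with the Euclidean metric; $G=G(\Lambda_n^{(d)},r(n))$ is the random geometric graph whose vertices form a Poisson point process of intensity $1$ on $\Lambda_n^{(d)}$, with edges between vertices at distance at most $r(n)$. $r_g$ is the critical radius above which $G$ has a giant component with high probability. $\gamma_d$ is the volume of the unit ball in $\mathbb{R}^d$. ''With high probability'' means with probability tending to $1$ as $n\to\infty$. *)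

(* Defs.v *)
From HB Require Import structures.
From mathcomp Require Import all_boot all_order all_algebra.
From mathcomp Require Import all_classical all_reals all_analysis.
Unset Printing Implicit Defensive.
Import Order.TTheory GRing.Theory Num.Theory.
Import numFieldNormedType.Exports.
Local Open Scope classical_set_scope.
Local Open Scope ring_scope.

Section RGG.
Variable R : realType.

(* A vector of m real variables is encoded as x : nat -> R (entries >= m
   are irrelevant).  [iint a b m F] is the iterated Lebesgue integral of
   F over [a,b]^m (integrating the variables m-1, ..., 0 from inside out). *)
Definition upd (x : nat -> R) (j : nat) (t : R) : nat -> R :=
  fun i => if i == j then t else x i.

Fixpoint iint (a b : R) (m : nat) (F : (nat -> R) -> \bar R) : \bar R :=
  match m with
  | 0 => F (fun _ => 0)
  | m'.+1 => (\int[lebesgue_measure]_(t in `[a, b]) iint a b m' (fun x => F (upd x m' t)))%E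
  end.

Definition unit_ball_vol (d : nat) : R :=
  fine (iint (-1) 1 d
    (fun x => ((\sum_(c < d) x c ^+ 2 <= 1)%R : bool)%:R%:E)).

Definition side (d n : nat) : R := n%:R `^ (d%:R^-1).

Definition tmod (L t : R) : R := t - L * (Num.floor (t / L))%:~R.

Definition tdist1 (L s t : R) : R := Num.min (tmod L (s - t)) (L - tmod L (s - t)).

(* A configuration of k points in the torus is x : nat -> R, point j having
   coordinate c (c < d) equal to x (j * d + c). *)
Definition pt (d : nat) (x : nat -> R) (j c : nat) : R := x (j * d + c).

Definition tdist (d n : nat) (x : nat -> R) (i j : nat) : R :=
  Num.sqrt (\sum_(c < d) tdist1 (side d n) (pt d x i c) (pt d x j c) ^+ 2)%R.

Definition adj (d n : nat) (r : R) (k : nat) (x : nat -> R) : rel 'I_k :=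
  fun i j => (i != j) && (tdist d n x i j <= r).

Definition degree (d n : nat) (r : R) (k : nat) (x : nat -> R) (j : 'I_k) : nat :=
  #|[set i | adj d n r k x j i]|.

(* ---------- the Poisson point process of intensity 1 on Lambda_n ----------
   An event is a predicate E k x on the number k of points and the
   (labelled) configuration x.  The number of points is Poisson(n) and,
   given k points, they are i.i.d. uniform on Lambda_n (density 1/n each):
     P(E) = sum_k e^{-n} n^k / k! * n^{-k} Leb^{dk}({x in Lambda_n^k | E k x}). *)
Definition PPP_prob (d n : nat) (E : nat -> (nat -> R) -> bool) : \bar R :=
  (\sum_(k <oo) ((expR (- n%:R) / k`!%:R)%:E *
     iint (- side d n / 2) (side d n / 2) (k * d)
          (fun x => (E k x)%:R%:E)))%E.

Definition whp (d : nat) (E : nat -> nat -> (nat -> R) -> bool) : Prop :=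
  ((fun n => PPP_prob d n (E n)) @ \oo --> 1%E).

Definition largest_comp (d n : nat) (r : R) (k : nat) (x : nat -> R) : nat :=
  \max_(i < k) #|[set j | connect (adj d n r k x) i j]|.

Definition has_giant (d : nat) (r : R) : Prop :=
  exists2 c : R, 0 < c &
    whp d (fun n k x => c * n%:R <= (largest_comp d n r k x)%:R).

Definition r_giant (d : nat) : R := inf [set r : R | 0 < r /\ has_giant d r].

(* the (closed, wrapping) cube with lower corner a and side length s contains
   the point p iff for all coordinates c, (p_c - a_c) mod L lies in [0, s] *)
Definition in_cube (d n : nat) (a : nat -> R) (s : R) (p : nat -> R) : bool :=
  [forall c : 'I_d, tmod (side d n) (p c - a c) <= s].

Definition in_torus (d n : nat) (p : nat -> R) : Prop :=
  forall c : nat, (c < d)%N -> - side d n / 2 <= p c <= side d n / 2.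

Definition cube_degsum (d n : nat) (r : R) (a : nat -> R) (s : R)
    (k : nat) (x : nat -> R) : nat :=
  \sum_(j < k | in_cube d n a s (pt d x j)) degree d n r k x j.

End RGG.
Arguments upd {R} x j t.
Arguments iint {R} a b m F.
Arguments tmod {R} L t.
Arguments tdist1 {R} L s t.
Arguments pt {R} d x j c.
Arguments tdist {R} d n x i j.
Arguments adj {R} d n r k x.
Arguments degree {R} d n r k x j.
Arguments PPP_prob {R} d n E.
Arguments whp {R} d E.
Arguments largest_comp {R} d n r k x.
Arguments in_cube {R} d n a s p.
Arguments in_torus {R} d n p.
Arguments cube_degsum {R} d n r a s k x.

(* Main.v *)
(** Since [r_giant >= 0], the radii are bounded away from [0] and infinity. Fix a
    cube [B] and let [B'] be its enlargement by [r]. The degree sum over [B] is at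
    most twice the number of pairs of points [i < j] at distance at most [r] with
    [j] in [B']. Integrating the points one after the other, the exponential
    moment of this count (each point contributing at most [D], of order [ln n])
    stays, for a tilt [lam] of order [1 / ln n], within a factor
    [expR (lam * mean * (1 + o(1)))]: the integral over one point of
    [expR (lam * min D w)] is at most the volume plus [lam * expR (lam * D)] times
    the integral of [w], which is linear in the number of remaining points in
    [B'], so that the next integration is again of the same form. As the mean is
    about half of the threshold, Markov's inequality with a large tilt gives a
    probability [o(1 / n)] per cube, which beats the union bound. The truncation
    at [D] and the number of points are controlled by exponential moments of
    counts in unit grid cubes and of the Poisson variable. *)
Require Import Defs.
From HB Require Import structures.
From mathcomp Require Import all_boot all_order all_algebra.
From mathcomp Require Import all_classical all_reals all_analysis.
From mathcomp Require Import measurable_realfun ring lra.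
Import Order.TTheory GRing.Theory Num.Theory.
Import numFieldNormedType.Exports.
Local Open Scope classical_set_scope.
Local Open Scope ring_scope.

Set Implicit Arguments.
Unset Strict Implicit.

(** The integral of a nonnegative function is a supremum over the simple functions below it, and
    this supremum is monotone for arbitrary integrands. Events can therefore be compared with
    measurable bounds directly. *)
Lemma le_integral_lower {d : measure_display} {T : measurableType d} {R : realType}
    (mu : {measure set T -> \bar R}) (D : set T) (f g : T -> \bar R) :
  (forall x, D x -> 0 <= f x)%E -> (forall x, D x -> f x <= g x)%E ->
  (\int[mu]_(x in D) f x <= \int[mu]_(x in D) g x)%E.
Proof.
move=> f0 fg; rewrite !ge0_integralE//; last first.
  by move=> x Dx; exact: le_trans (f0 x Dx) (fg x Dx).
apply: le_ereal_sup => _ [h /= hf <-]; exists h => //= x.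
apply: le_trans (hf x) _; rewrite /patch; case: ifPn => // /[1!inE] Dx.
exact: fg.
Qed.

(** * Iterated integrals: monotonicity, regrouping, measurability, linearity *)

Section IteratedIntegral.
Variable R : realType.
Implicit Types (a b : R) (m k q p : nat) (F G : (nat -> R) -> \bar R).

(** The vectors at which [iint a b m] evaluates its integrand: its base case is the zero vector,
    hence the zeros from index [m] on. *)
Definition in_box a b m (x : nat -> R) : Prop :=
  (forall i, (i < m)%N -> a <= x i <= b) /\ (forall i, (m <= i)%N -> x i = 0).

Lemma in_box_upd a b m x (t : R) : in_box a b m x -> a <= t <= b ->
  in_box a b m.+1 (upd x m t).
Proof.
move=> [xm x0] abt; split=> i im; rewrite /upd; have [e|ne] := eqVneq i m => //.
- by apply: xm; rewrite ltn_neqAle ne -ltnS.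
- by rewrite e ltnn in im.
- by apply: x0; rewrite ltnW.
Qed.

Lemma iint_ge0 a b m F : (forall x, 0 <= F x)%E -> (0 <= iint a b m F)%E.
Proof.
elim: m F => [|m IH] F F0 /=; first exact: F0.
by apply: integral_ge0 => t _; exact: IH.
Qed.

Lemma le_iint a b m F G : (forall x, 0 <= F x)%E ->
  (forall x, in_box a b m x -> F x <= G x)%E -> (iint a b m F <= iint a b m G)%E.
Proof.
elim: m F G => [|m IH] F G F0 FG /=; first by apply: FG; split.
apply: le_integral_lower => t /= tab; first exact: iint_ge0.
apply: IH => // x xm; apply: FG; exact: in_box_upd.
Qed.

Lemma eq_iint a b m F G : (forall x, in_box a b m x -> F x = G x) ->
  iint a b m F = iint a b m G.
Proof.
elim: m F G => [|m IH] F G FG /=; first by apply: FG; split.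
apply: eq_integral => t /[!inE]/= tab; apply: IH => // x xm; apply: FG.
exact: in_box_upd.
Qed.

Definition glue q (x y : nat -> R) : nat -> R :=
  fun i => if (i < q)%N then x i else y (i - q)%N.

(** Variables of large index are outermost in [iint], so this only regroups nested integrals and
    exchanges no order of integration. With [q = d] it isolates the first point. *)
Lemma iint_glue a b q p F :
  iint a b (q + p) F = iint a b p (fun y => iint a b q (fun x => F (glue q x y))).
Proof.
elim: p F => [|p IH] F.
  rewrite addn0 /=; apply: eq_iint => x [_ x0]; congr F; apply/funext => i.
  by rewrite /glue; case: ltnP => // /x0.
rewrite addnS /=; apply: eq_integral => t _; rewrite IH.
apply: eq_iint => y _; apply: eq_iint => x _; congr F; apply/funext => i.
rewrite /glue /upd; case: ltnP => iq.
  by case: eqP => // e; move: iq; rewrite e ltnNge leq_addr.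
by rewrite -(eqn_add2r q (i - q)%N) subnK// addnC.
Qed.

(* Measurability along every measurable family of vectors; this stands in for
   measurability with respect to the product sigma-algebra on [nat -> R]. *)
Definition vmeas {dV : measure_display} {V : measurableType dV}
    (F : (nat -> R) -> V) : Prop :=
  forall (dT : measure_display) (T : measurableType dT) (f : T -> nat -> R),
    (forall i, measurable_fun setT (f ^~ i)) ->
    measurable_fun setT (fun t => F (f t)).

Lemma measurable_upd (dT : measure_display) (T : measurableType dT)
    (f : T -> nat -> R) (g : T -> R) m :
  (forall i, measurable_fun setT (f ^~ i)) -> measurable_fun setT g ->
  forall i, measurable_fun setT (fun t => upd (f t) m (g t) i).
Proof. by move=> mf mg i; rewrite /upd; case: eqP. Qed.

(** Induction on [m] with Tonelli on [T * R]. Quantifying over all measurable families [g], [f]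
    makes the hypothesis stable when an integration variable joins the parameter. *)
Lemma measurable_iint a b m (dT : measure_display) (T : measurableType dT)
    (F : T -> (nat -> R) -> \bar R) :
  (forall t x, 0 <= F t x)%E ->
  (forall (dS : measure_display) (S : measurableType dS) (g : S -> T)
     (f : S -> nat -> R), measurable_fun setT g ->
     (forall i, measurable_fun setT (f ^~ i)) ->
     measurable_fun setT (fun s => F (g s) (f s))) ->
  measurable_fun setT (fun t => iint a b m (F t)).
Proof.
elim: m dT T F => [|m IH] dT T F F0 mF /=.
  exact: (mF _ _ id).
pose G (z : T * R) := iint a b m (fun x => F z.1 (upd x m z.2)).
have mG : measurable_fun setT G.
  apply: (IH _ _ (fun z x => F z.1 (upd x m z.2))) => // dS S g f mg mf.
  apply: (mF _ _ (fun s => (g s).1)); first exact: (measurableT_comp measurable_fst mg).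
  by apply: measurable_upd => //; exact: (measurableT_comp measurable_snd mg).
(* Tonelli is applied to integrals over the whole line, so the range [[a, b]] is encoded by
   restriction to a strip. *)
pose D : set (T * R) := [set z | z.2 \in `[a, b]].
have mD : measurable D.
  rewrite (_ : D = setT `&` snd @^-1` `[a, b]%classic); last first.
    by apply/seteqP; split => z //= [].
  exact: measurable_snd.
have mGD : measurable_fun setT (G \_ D).
  by apply/(measurable_restrictT _ mD); exact: measurable_funTS.
have GD0 z : (0 <= (G \_ D) z)%E.
  by rewrite /patch; case: ifP => // _; exact: iint_ge0.
have := measurable_fun_fubini_tonelli_F (m2 := lebesgue_measure) _ mGD GD0.
apply: eq_measurable_fun => t _; rewrite /fubini_F [RHS]integral_mkcond.
apply: eq_integral => s _; rewrite /patch.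
by rewrite -!/(in_mem _ _); have [sab|sab] := boolP (s \in `[a, b]%classic);
  [rewrite ifT// inE; move: sab; rewrite inE
  |rewrite ifF//; apply: contraNF sab; rewrite !inE].
Qed.

Lemma vmeas_upd (dV : measure_display) (V : measurableType dV)
    (F : (nat -> R) -> V) m (t : R) :
  vmeas F -> vmeas (fun x => F (upd x m t)).
Proof. by move=> mF dT T f mf; apply: mF; exact: measurable_upd. Qed.

Lemma measurable_iint_upd a b m F (D : set R) : (forall x, 0 <= F x)%E -> vmeas F ->
  measurable_fun D (fun t => iint a b m (fun x => F (upd x m t))).
Proof.
move=> F0 mF; apply: measurable_funTS.
apply: (@measurable_iint _ _ _ _ _ (fun t x => F (upd x m t))) => //.
move=> dS S g f mg mf; apply: mF; exact: measurable_upd.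
Qed.

Lemma iintD a b m F G : (forall x, 0 <= F x)%E -> vmeas F ->
  (forall x, 0 <= G x)%E -> vmeas G ->
  iint a b m (fun x => F x + G x)%E = (iint a b m F + iint a b m G)%E.
Proof.
elim: m F G => [|m IH] F G F0 mF G0 mG //=.
under eq_integral do (rewrite IH//; try exact: vmeas_upd).
rewrite ge0_integralD//.
- by move=> t _; exact: iint_ge0.
- exact: measurable_iint_upd.
- by move=> t _; exact: iint_ge0.
- exact: measurable_iint_upd.
Qed.

Lemma iintZl a b m F (c : R) : 0 <= c -> (forall x, 0 <= F x)%E -> vmeas F ->
  iint a b m (fun x => c%:E * F x)%E = (c%:E * iint a b m F)%E.
Proof.
elim: m F => [|m IH] F c0 F0 mF //=.
under eq_integral do (rewrite IH//; last exact: vmeas_upd).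
rewrite ge0_integralZl_EFin//.
- by move=> t _; exact: iint_ge0.
- exact: measurable_iint_upd.
Qed.

Lemma iint_sum a b m (I : Type) (s : seq I) (F : I -> (nat -> R) -> \bar R) :
  (forall i x, 0 <= F i x)%E -> (forall i, vmeas (F i)) ->
  iint a b m (fun x => \sum_(i <- s) F i x)%E = (\sum_(i <- s) iint a b m (F i))%E.
Proof.
move=> F0 mF; elim: m F F0 mF => [|m IH] F F0 mF //=.
under eq_integral do (rewrite IH//; last by move=> i; exact: vmeas_upd).
rewrite ge0_integral_sum//.
- by move=> i; exact: measurable_iint_upd.
- by move=> i t _; exact: iint_ge0.
Qed.

Lemma iint_cst a b m (c : R) : a <= b ->
  iint a b m (fun=> c%:E) = (c * (b - a) ^+ m)%:E.
Proof.
move=> ab; elim: m => [|m IH] /=; first by rewrite mulr1.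
under eq_integral do rewrite IH.
rewrite integral_cst//= lebesgue_measure_itv /= lte_fin.
case: ltgtP ab => // [ab|->] _; first by rewrite -EFinB -EFinM exprSr mulrA.
by rewrite mule0 subrr expr0n /= mulr0.
Qed.
End IteratedIntegral.

(** * One-dimensional integrals: affine substitution and the circle *)

Section OneDimensionalIntegrals.
Variable R : realType.
Local Notation mu := (@lebesgue_measure R).
Implicit Types (a p q x y L r : R) (f g h : R -> \bar R).

(** By uniqueness of Lebesgue measure on half-open intervals, its image under the affine map, scaled
    by [k], is Lebesgue measure again. *)
Lemma ge0_integral_affine (k b p q : R) f : 0 < k ->
  measurable_fun setT f -> (forall x, 0 <= f x)%E ->
  (\int[mu]_(x in `[p, q]) f (k * x + b)%R =
   k^-1%:E * \int[mu]_(u in `[(k * p + b)%R, (k * q + b)%R]) f u)%E.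
Proof.
move=> k0 mf f0; pose phi (x : measurableTypeR R) : measurableTypeR R := k * x + b.
have mphi : measurable_fun setT phi.
  by apply: measurable_funD => //; exact: mulrl_measurable.
pose nu : {measure set (measurableTypeR R) -> \bar R} :=
  measure_function_pushforward__canonical__measure_function_Measure mu mphi.
have mu_nu A : measurable A -> mu A = (k%:E * nu A)%E.
  apply: (@lebesgue_measure_unique _ (mscale (NngNum (ltW k0)) nu)) => // _ [[s t] _ <-].
  rewrite [RHS](_ : _ = (k%:E * mu (phi @^-1` `]s, t]%classic))%E)//.
  rewrite (_ : phi @^-1` `]s, t]%classic = `](s - b) / k, (t - b) / k]%classic); last first.
    apply/seteqP; split => z /=; rewrite !in_itv /= ltr_pdivrMr// ler_pdivlMr//;
      by rewrite ltrBlDr lerBrDr /phi (mulrC k).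
  rewrite !lebesgue_measure_itv /= !lte_fin ltr_pM2r ?invr_gt0// ltrD2r.
  case: ifP => _; last by rewrite mule0.
  by rewrite -!EFinB -EFinM; congr EFin; field; rewrite gt_eqF.
rewrite (_ : `[p, q]%classic = phi @^-1` `[k * p + b, k * q + b]%classic); last first.
  by apply/seteqP; split => z /=; rewrite !in_itv /= !lerD2r !ler_pM2l.
have mfD : measurable_fun (T := measurableTypeR R) `[k * p + b, k * q + b] f.
  exact: measurable_funTS.
have := @ge0_integral_pushforward _ _ _ _ _ phi mphi mu `[k * p + b, k * q + b]%classic f
  (measurable_itv _) mfD (fun _ _ => f0 _).
rewrite /comp => <-.
have k10 : 0 <= k^-1 by rewrite invr_ge0 ltW.
rewrite -[in RHS](@ge0_integral_mscale _ (measurableTypeR R) _ mu _ _ (NngNum k10))//.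
apply: (@eq_measure_integral _ (measurableTypeR R) _ _ (mscale (NngNum k10) mu) nu) => A mA _.
rewrite [RHS](_ : _ = (k^-1%:E * mu A)%E)// mu_nu// muleA -EFinM mulVf ?mul1e//.
by rewrite gt_eqF.
Qed.

Lemma ge0_integral_split p q c f : p <= c <= q ->
  measurable_fun setT f -> (forall x, 0 <= f x)%E ->
  (\int[mu]_(x in `[p, q]) f x =
   \int[mu]_(x in `[p, c]) f x + \int[mu]_(x in `[c, q]) f x)%E.
Proof.
move=> /andP[pc cq] mf f0.
rewrite (@itv_bndbnd_setU _ _ (BLeft p) (BLeft c) (BRight q)) ?bnd_simp//.
rewrite ge0_integral_setU//; last 2 first.
- exact: measurable_funTS.
- apply/disj_setPRL => x /=; rewrite !in_itv /= => /andP[cx _] /andP[_].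
  by rewrite ltNge cx.
by rewrite integral_itv_bndo_bndc//; exact: measurable_funTS.
Qed.

Lemma measurable_tmod L : measurable_fun setT (@tmod R L).
Proof.
have mfl : measurable_fun setT (fun t : R => (Num.floor t)%:~R : R).
  by apply: nondecreasing_measurable => // s t st; rewrite ler_int; exact: le_floor.
apply: measurable_funB => //; apply: measurable_funM => //.
exact: (measurableT_comp mfl (mulrr_measurable L^-1)).
Qed.

Lemma tmod_ge0_lt L x : 0 < L -> 0 <= tmod L x < L.
Proof.
move=> L0; rewrite /tmod.
have := floor_le (x / L); have := floorD1_gt (x / L).
rewrite ltr_pdivrMr// ler_pdivlMr// => A B.
apply/andP; split; first by lra.
by rewrite intrD mulrDl mul1r in A; lra.
Qed.

Lemma tmod_uniq L x (j : int) : 0 < L -> 0 <= x - L * j%:~R < L ->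
  tmod L x = x - L * j%:~R.
Proof.
move=> L0 /andP[A B]; rewrite /tmod (floor_def (m := j))//.
by rewrite ler_pdivlMr// ltr_pdivrMr// intrD mulrDl mul1r; apply/andP; split; lra.
Qed.

(** Translation invariance on the circle: [tmod L (y - a)] consists of two translations, whose
    images tile [[0, L]]. *)
Lemma ge0_integral_tmod L a h : 0 < L ->
  measurable_fun setT h -> (forall x, 0 <= h x)%E ->
  (\int[mu]_(y in `[(- L / 2)%R, (L / 2)%R]) h (tmod L (y - a)%R) =
   \int[mu]_(u in `[0%R, L]) h u)%E.
Proof.
move=> L0 mh h0.
(* [th] is the residue at the left endpoint and [j] its number of turns; the residue jumps back to
   [0] at [c]. *)
set j := Num.floor ((- L / 2 - a) / L); pose th := - L / 2 - a - L * j%:~R.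
have /andP[th0 thL] : 0 <= th < L by exact: tmod_ge0_lt.
pose c := - L / 2 + (L - th).
have mhm : measurable_fun setT (fun y => h (tmod L (y - a))).
  apply: (measurableT_comp mh); apply: (measurableT_comp (measurable_tmod L)).
  exact: measurable_funB.
rewrite (@ge0_integral_split _ _ c)//; last by rewrite /c; apply/andP; split; lra.
rewrite (@ge0_integral_split 0 L th)//; last by rewrite th0 ltW.
rewrite addeC; congr (_ + _)%E.
  under eq_integral => y.
    rewrite inE /= in_itv /= => /andP[cy yL].
    rewrite (tmod_uniq (j := j + 1)) //; last first.
      by rewrite intrD mulrDr mulr1; move: cy yL; rewrite /c /th => ? ?;
        apply/andP; split; move: th0 thL; rewrite /th; lra.
    rewrite (_ : y - a - L * (j + 1)%:~R = 1 * y + (- a - L * (j + 1)%:~R));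
      last by rewrite mul1r; ring.
    over.
  rewrite (@ge0_integral_affine 1)// invr1 mul1e.
  have -> : 1 * c + (- a - L * (j + 1)%:~R) = 0 by rewrite /c /th intrD; lra.
  by have -> : 1 * (L / 2) + (- a - L * (j + 1)%:~R) = th by rewrite /th intrD; lra.
(* At [c] the affine formula gives [L] but [tmod] gives [0], so this endpoint is removed during the
   substitution. *)
rewrite -integral_itv_bndo_bndc; last exact: measurable_funTS.
under eq_integral => y.
  rewrite inE /= in_itv /= => /andP[cy yL].
  rewrite (tmod_uniq (j := j)) //; last first.
    by move: cy yL; rewrite /c /th => ? ?; apply/andP; split; move: th0 thL; rewrite /th; lra.
  rewrite (_ : y - a - L * j%:~R = 1 * y + (- a - L * j%:~R));
    last by rewrite mul1r; ring.
  over.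
rewrite integral_itv_bndo_bndc; last first.
  apply: measurable_funTS; apply: (measurableT_comp mh).
  by apply: measurable_funD => //; exact: mulrl_measurable.
rewrite (@ge0_integral_affine 1)// invr1 mul1e.
have -> : 1 * c + (- a - L * j%:~R) = L by rewrite /c /th; lra.
by have -> : 1 * (- L / 2) + (- a - L * j%:~R) = th by rewrite /th; lra.
Qed.

(** On [[0, L]] the circle distance is the minimum of [u] and [L - u]; the parts near [0] and near
    [L] become the two halves of [[-r, r]]. Only an inequality holds, since the two parts overlap
    when [r] exceeds [L / 2]. *)
Lemma ge0_integral_tdist1 L x r g : 0 < L -> 0 < r ->
  measurable_fun setT g -> (forall u, 0 <= g u)%E -> (forall u, r < u -> g u = 0%E) ->
  (\int[mu]_(y in `[(- L / 2)%R, (L / 2)%R]) g (tdist1 L y x) <=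
   r%:E * \int[mu]_(v in `[(-1)%R, 1%R]) g `|r * v|%R)%E.
Proof.
move=> L0 r0 mg g0 gr.
pose h u := g (Num.min u (L - u)).
have mh : measurable_fun setT h.
  apply: (measurableT_comp mg); apply: measurable_minr => //.
  exact: measurable_funB.
rewrite (@ge0_integral_tmod L x h)//; last by move=> u; exact: g0.
pose g1 : R -> \bar R := (fun u : R => g `|u|) \_ `[0, r].
pose g2 : R -> \bar R := (fun u : R => g `|u - L|) \_ `[L - r, L].
have mgn : measurable_fun setT (fun u : R => g `|u|).
  by apply: (measurableT_comp mg); exact: normr_measurable.
have mgL : measurable_fun setT (fun u : R => g `|u - L|).
  by apply: (measurableT_comp mgn (f := fun u : R => g `|u|)); exact: measurable_funB.
have g10 u : (0 <= g1 u)%E by rewrite /g1 /patch; case: ifP.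
have g20 u : (0 <= g2 u)%E by rewrite /g2 /patch; case: ifP.
have mg1 : measurable_fun setT g1.
  by apply/(measurable_restrictT _ (measurable_itv _)); exact: measurable_funTS.
have mg2 : measurable_fun setT g2.
  by apply/(measurable_restrictT _ (measurable_itv _)); exact: measurable_funTS.
have h12 u : `[0, L]%classic u -> (h u <= g1 u + g2 u)%E.
  rewrite /= in_itv /= => /andP[u0 uL]; rewrite /h /Num.min; case: ifP => _.
    have [ur|/gr -> //] := leP u r; last exact: adde_ge0.
    rewrite /g1 /patch ifT; last by rewrite inE /= in_itv /= u0.
    by rewrite ger0_norm// leeDl.
  have [ur|/gr -> //] := leP (L - u) r; last exact: adde_ge0.
  rewrite addeC /g2 /patch ifT; last by rewrite inE /= in_itv /= uL andbT; lra.
  by rewrite distrC ger0_norm ?subr_ge0// leeDl.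
apply: (@le_trans _ _ (\int[mu]_(u in `[0%R, L]) (g1 u + g2 u))%E).
  by apply: le_integral_lower => [u _|]; [exact: g0|exact: h12].
rewrite ge0_integralD//; try exact: measurable_funTS.
have -> : (r%:E * \int[mu]_(v in `[(-1)%R, 1%R]) g `|(r * v)%R|%R =
  \int[mu]_(v in `[(- r)%R, r]) g `|v|%R)%E.
  have := @ge0_integral_affine r 0 (-1) 1 (fun u : R => g `|u|) r0 mgn (fun=> g0 _).
  under eq_integral do rewrite addr0.
  move=> ->; rewrite muleA -EFinM divff ?gt_eqF// mul1e.
  by rewrite mulrN1 mulr1 !addr0.
rewrite (@ge0_integral_split (- r) r 0)//; last by rewrite oppr_le0 !ltW.
rewrite addeC; apply: leeD.
  apply: (@le_trans _ _ (\int[mu]_u g2 u)%E).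
    apply: ge0_subset_integral => //; exact: measurable_funTS.
  rewrite /g2 -integral_mkcond.
  apply: (@le_trans _ _ (\int[mu]_(u in `[(L - r)%R, L]) g `|1 * u + - L|%R)%E).
    by apply: le_integral_lower => // u _; rewrite mul1r.
  rewrite (@ge0_integral_affine 1 (- L) (L - r) L (fun u : R => g `|u|))//.
  rewrite invr1 mul1e !mul1r subrr.
  by rewrite (_ : L - r - L = - r)//; lra.
apply: (@le_trans _ _ (\int[mu]_u g1 u)%E).
  apply: ge0_subset_integral => //; exact: measurable_funTS.
by rewrite /g1 -integral_mkcond.
Qed.
End OneDimensionalIntegrals.

(** * Volumes of cubes and balls on the torus *)

Section Volumes.
Variable R : realType.
Local Notation mu := (@lebesgue_measure R).

Lemma measurable_bool_natr (dT : measure_display) (T : measurableType dT) (b : T -> bool) :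
  measurable_fun setT b -> measurable_fun setT (fun t => (b t)%:R : R).
Proof.
move=> mb.
rewrite (_ : (fun t => _) = fun t => if b t then 1 else 0); last first.
  by apply/funext => t; case: (b t).
exact: measurable_fun_ifT.
Qed.

Lemma measurable_tmod_comp (dT : measure_display) (T : measurableType dT) (L : R)
    (f : T -> R) : measurable_fun setT f ->
  measurable_fun setT (fun t => tmod L (f t)).
Proof. by move=> mf; exact: (measurableT_comp (measurable_tmod L) mf). Qed.

Lemma measurable_tdist1 (dT : measure_display) (T : measurableType dT) (L : R)
    (f g : T -> R) : measurable_fun setT f -> measurable_fun setT g ->
  measurable_fun setT (fun t => tdist1 L (f t) (g t)).
Proof.
move=> mf mg.
have mt : measurable_fun setT (fun t => tmod L (f t - g t)).
  by apply: measurable_tmod_comp; exact: measurable_funB.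
by apply: measurable_minr => //; exact: measurable_funB.
Qed.

Lemma iint_prod (a b : R) m (f : nat -> R -> R) (I : nat -> R) :
  (forall c t, 0 <= f c t) -> (forall c, measurable_fun setT (f c)) ->
  (forall c, (c < m)%N -> \int[mu]_(t in `[a, b]) (f c t)%:E = (I c)%:E)%E ->
  iint a b m (fun x => (\prod_(c < m) f c (x c))%:E) = (\prod_(c < m) I c)%:E.
Proof.
move=> f0 mf; elim: m => [|m IH] fI /=; first by rewrite !big_ord0.
have P0 : 0 <= \prod_(c < m) I c.
  apply: prodr_ge0 => c _; rewrite -lee_fin -fI; last by rewrite ltnS ltnW.
  by apply: integral_ge0 => t _; rewrite lee_fin.
transitivity (\int[mu]_(t in `[a, b]) ((\prod_(c < m) I c)%:E * (f m t)%:E))%E.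
  apply: eq_integral => t _.
  rewrite (@eq_iint _ _ _ _ _ (fun x => (f m t)%:E * (\prod_(c < m) f c (x c))%:E)%E).
    rewrite iintZl// ?IH 1?muleC//.
    - by move=> c cm; apply: fI; rewrite ltnS ltnW.
    - by move=> x; rewrite lee_fin; apply: prodr_ge0.
    - move=> dT T g mg; apply/measurable_EFinP; apply: measurable_prod => c _.
      exact: (measurableT_comp (mf c) (mg c)).
  move=> x _; rewrite -EFinM mulrC big_ord_recr /=; congr (_ * _)%:E.
    by apply: eq_bigr => c _; rewrite /upd ltn_eqF.
  by rewrite /upd eqxx.
rewrite ge0_integralZl_EFin//.
- by rewrite fI// big_ord_recr.
- by move=> t _; rewrite lee_fin.
- by apply: measurable_funTS; apply/measurable_EFinP; exact: mf.
Qed.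

Lemma integral_le_interval (L s : R) : 0 <= s ->
  (\int[mu]_(u in `[0%R, L]) (u <= s)%R%:R%:E <= s%:E)%E.
Proof.
move=> s0; rewrite integral_mkcond.
apply: (@le_trans _ _ (\int[mu]_(u in `[0%R, s]) (cst 1%E u))%E); last first.
  rewrite integral_cst//= mul1e lebesgue_measure_itv /= lte_fin.
  by case: ifP => _; rewrite ?sube0.
rewrite [leRHS]integral_mkcond; apply: le_integral_lower => u _.
  by rewrite /patch; case: ifP => // _; rewrite lee_fin.
rewrite /patch; case: ifPn => [|_]; last by case: ifP => // _; rewrite lee_fin.
rewrite inE /= in_itv /= => /andP[u0 uL].
have [us|us] := leP u s; last by case: ifP => // _; rewrite lee_fin.
by rewrite ifT// inE /= in_itv /= u0.
Qed.

Lemma in_cube_natr d n (a : nat -> R) s p :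
  (in_cube d n a s p)%:R = \prod_(c < d) (tmod (side R d n) (p c - a c) <= s)%R%:R :> R.
Proof.
rewrite /in_cube; case: forallP => [H|H].
  by rewrite big1// => c _; rewrite H.
apply/esym/eqP; rewrite prodf_seq_eq0; apply/hasP.
have /existsNP[c /negP cs] := H.
by exists c; rewrite ?mem_index_enum//= (negbTE cs).
Qed.

Lemma measurable_in_cube (dT : measure_display) (T : measurableType dT) d n
    (a : nat -> R) s (f : T -> nat -> R) : (forall i, measurable_fun setT (f ^~ i)) ->
  measurable_fun setT (fun t => (in_cube d n a s (f t))%:R : R).
Proof.
move=> mf; under eq_fun do rewrite in_cube_natr.
apply: measurable_prod => c _; apply: measurable_bool_natr.
apply: measurable_fun_ler => //.
apply: measurable_tmod_comp; exact: measurable_funB.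
Qed.

Lemma iint_in_cube d n (a : nat -> R) s : 0 < side R d n -> 0 <= s ->
  (iint (- side R d n / 2) (side R d n / 2) d (fun x => (in_cube d n a s x)%:R%:E)
    <= (s ^+ d)%:E)%E.
Proof.
move=> L0 s0; set L := side R d n in L0 *.
under eq_iint do rewrite in_cube_natr -/L.
pose f c t : R := (tmod L (t - a c) <= s)%R%:R.
pose J := (\int[mu]_(u in `[0%R, L]) (u <= s)%R%:R%:E)%E.
have J0 : (0 <= J)%E by apply: integral_ge0 => u _; rewrite lee_fin.
have Js : (J <= s%:E)%E by exact: integral_le_interval.
have JE : J = (fine J)%:E.
  by rewrite fineK// ge0_fin_numE// (le_lt_trans Js)// ltry.
have mfc c : measurable_fun setT (f c).
  apply: measurable_bool_natr; apply: measurable_fun_ler => //.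
  apply: measurable_tmod_comp; exact: measurable_funB.
rewrite (@iint_prod _ _ d f (fun=> fine J))//.
- rewrite lee_fin big_const_ord iter_mulr_1 lerXn2r ?nnegrE ?fine_ge0//.
  by rewrite -lee_fin -JE.
- move=> c _; rewrite -JE /J.
  rewrite -(@ge0_integral_tmod _ L (a c) (fun u => (u <= s)%R%:R%:E))//.
  apply/measurable_EFinP; apply: measurable_bool_natr.
  exact: measurable_fun_ler.
Qed.

(** Adjacency by squared distance, free of the square root in [tdist] and stated for points instead
    of indices. *)
Definition near_pt d n (r : R) (p q : nat -> R) : bool :=
  \sum_(c < d) tdist1 (side R d n) (p c) (q c) ^+ 2 <= r ^+ 2.

Lemma measurable_near_pt (dT : measure_display) (T : measurableType dT) d n r
    (f g : T -> nat -> R) : (forall i, measurable_fun setT (f ^~ i)) ->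
  (forall i, measurable_fun setT (g ^~ i)) ->
  measurable_fun setT (fun t => (near_pt d n r (f t) (g t))%:R : R).
Proof.
move=> mf mg; apply: measurable_bool_natr; apply: measurable_fun_ler => //.
apply: measurable_sum => c; apply: measurable_funX.
exact: measurable_tdist1.
Qed.

(* Peeling off the last coordinate replaces the squared radius [T] by
   [T - t ^+ 2], hence the induction is over all [T <= r ^+ 2]. *)
Lemma iint_torus_ball_le (L r : R) (y : nat -> R) m T : 0 < L -> 0 < r -> T <= r ^+ 2 ->
  (iint (- L / 2) (L / 2) m
     (fun x => (\sum_(c < m) tdist1 L (x c) (y c) ^+ 2 <= T)%R%:R%:E) <=
   (r ^+ m)%:E *
   iint (-1) 1 m (fun v => (\sum_(c < m) (r * v c) ^+ 2 <= T)%R%:R%:E))%E.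
Proof.
move=> L0 r0; elim: m T => [|m IH] T Tr /=; first by rewrite !big_ord0 mul1e.
pose J S := iint (-1) 1 m (fun v => (\sum_(c < m) (r * v c) ^+ 2 <= S)%R%:R%:E).
have J0 S : (0 <= J S)%E by apply: iint_ge0 => v; rewrite lee_fin.
(* The inductive bound for the slice at circle distance [u] in the last coordinate; it vanishes for
   [u > r], where the remaining squared radius is negative. *)
pose g (u : R) := ((r ^+ m)%:E * J (T - u ^+ 2)%R)%E.
have mJ : measurable_fun setT (fun u : R => J (T - u ^+ 2)).
  rewrite /J; apply: (@measurable_iint R (-1) 1 m _ _ (fun (u : R) v => (\sum_(c < m) (r * v c) ^+ 2 <= T - u ^+ 2)%R%:R%:E)) => //.
  move=> dS S h f mh mf; apply/measurable_EFinP; apply: measurable_bool_natr.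
  apply: measurable_fun_ler.
    by apply: measurable_sum => c; apply: measurable_funX; apply: measurable_funM.
  by apply: measurable_funB => //; exact: measurable_funX.
have mg : measurable_fun setT g by apply: measurable_funeM.
have g0 u : (0 <= g u)%E by rewrite mule_ge0// lee_fin exprn_ge0// ltW.
have gr u : r < u -> g u = 0%E.
  move=> ru; rewrite /g (_ : J _ = 0%E) ?mule0// /J.
  rewrite (@eq_iint _ _ _ _ _ (fun=> 0%:E)); first by rewrite iint_cst ?mul0r//; lra.
  move=> v _; rewrite leNgt (lt_le_trans (y := 0))//.
    rewrite subr_lt0 (le_lt_trans Tr)// ltr_pXn2r// nnegrE ltW//.
    exact: lt_trans ru.
  by apply: sumr_ge0 => c _; rewrite sqr_ge0.
apply: (@le_trans _ _ (\int[mu]_(t in `[(- L / 2)%R, (L / 2)%R]) g (tdist1 L t (y m)))%E).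
  apply: le_integral_lower => t _; first by apply: iint_ge0 => x; rewrite lee_fin.
  apply: le_trans (IH (T - tdist1 L t (y m) ^+ 2) _); last first.
    by rewrite lerBlDr (le_trans Tr)// lerDl sqr_ge0.
  apply: le_iint => [x|x _]; first by rewrite lee_fin.
  rewrite big_ord_recr /= {2}/upd eqxx lerBrDr.
  rewrite (eq_bigr (fun c : 'I_m => tdist1 L (x c) (y c) ^+ 2))// => c _.
  by rewrite /upd ltn_eqF.
apply: le_trans (ge0_integral_tdist1 _ L0 r0 mg g0 gr) _.
under eq_integral do rewrite /g.
rewrite ge0_integralZl_EFin//; last 2 first.
- apply: measurable_funTS; apply: (measurableT_comp mJ (f := fun u : R => J (T - u ^+ 2))).
  by apply: (measurableT_comp (@normr_measurable _ _)); exact: mulrl_measurable.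
- by rewrite exprn_ge0// ltW.
rewrite muleA -EFinM -exprS lee_pmul2l ?fin_numE// ?lte_fin ?exprn_gt0//.
apply: le_integral_lower => v _ //; rewrite /J; apply: le_iint => [x|x _].
  by rewrite lee_fin.
rewrite big_ord_recr /= {2}/upd eqxx lerBrDr real_normK ?num_real//.
rewrite [in leRHS](eq_bigr (fun c : 'I_m => (r * x c) ^+ 2))// => c _.
by rewrite /upd ltn_eqF.
Qed.

(** The ball indicator is at most [1] on [[-1, 1]^d], so the integral is finite and [fine] loses
    nothing. *)
Lemma unit_ball_volE d : iint (-1) 1 d
    (fun x => ((\sum_(c < d) x c ^+ 2 <= 1)%R : bool)%:R%:E) = (unit_ball_vol R d)%:E.
Proof.
rewrite /unit_ball_vol fineK// ge0_fin_numE; last first.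
  by apply: iint_ge0 => x; rewrite lee_fin.
apply: (@le_lt_trans _ _ (iint (-1) 1 d (fun=> 1%:E : \bar R))).
  by apply: le_iint => [x|x _]; rewrite lee_fin// lern1 leq_b1.
by rewrite iint_cst ?ltry//; lra.
Qed.

Lemma iint_near_pt d n r (q : nat -> R) : 0 < side R d n -> 0 < r ->
  (iint (- side R d n / 2) (side R d n / 2) d (fun x => (near_pt d n r x q)%:R%:E)
    <= (unit_ball_vol R d * r ^+ d)%:E)%E.
Proof.
move=> L0 r0.
apply: le_trans (iint_torus_ball_le q d L0 r0 (lexx _)) _.
rewrite mulrC EFinM -unit_ball_volE lee_pmul2l ?fin_numE ?lte_fin ?exprn_gt0//.
apply: le_iint => [v|v _]; first by rewrite lee_fin.
under eq_bigr do rewrite exprMn.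
by rewrite -mulr_sumr -[X in _ <= X]mulr1 ler_pM2l// exprn_gt0.
Qed.

Lemma unit_ball_vol_gt0 d : (0 < d)%N -> 0 < unit_ball_vol R d.
Proof.
move=> d0; rewrite -lte_fin -unit_ball_volE.
have dR : 1 <= d%:R :> R by rewrite ler1n.
have e0 : 0 < d%:R^-1 :> R by rewrite invr_gt0; lra.
have e1 : d%:R^-1 <= 1 :> R by rewrite invf_le1//; lra.
(* The cube of half-side [1 / d] lies in the unit ball, because [d * (1 / d) ^ 2 <= 1]. *)
pose f (c : nat) (t : R) : R := (`|t| <= d%:R^-1)%R%:R.
have mf c : measurable_fun setT (f c).
  apply: (@measurable_bool_natr _ R (fun t => `|t| <= d%:R^-1)).
  by apply: measurable_fun_ler => //; exact: normr_measurable.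
have fI c : (\int[mu]_(t in `[(-1)%R, 1%R]) (f c t)%:E = (d%:R^-1 *+ 2)%:E)%E.
  transitivity (\int[mu]_(t in `[(- d%:R^-1)%R, (d%:R^-1)%R]) (cst 1%E t))%E.
    rewrite [LHS]integral_mkcond [RHS]integral_mkcond; apply: eq_integral => t _.
    rewrite /patch /f !mem_setE !in_itv /= -!ler_norml.
    have [te|te] := leP `|t| d%:R^-1; last by case: ifP.
    by rewrite ifT// (le_trans te).
  rewrite integral_cst//= mul1e lebesgue_measure_itv /= lte_fin ifT; last by lra.
  by rewrite -EFinB opprK mulr2n.
apply: (@lt_le_trans _ _ (iint (-1) 1 d (fun x => (\prod_(c < d) f c (x c))%:E))).
  rewrite (@iint_prod _ _ _ f (fun=> d%:R^-1 *+ 2))// lte_fin.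
  by apply: prodr_gt0 => c _; rewrite mulrn_wgt0.
apply: le_iint => [x|x _]; rewrite lee_fin; first by apply: prodr_ge0.
have [/allP H|] := boolP (all (fun c : 'I_d => `|x c| <= d%:R^-1) (index_enum _)).
  rewrite [X in _ <= X](_ : _ = 1).
    by rewrite big1// => c _; rewrite /f H// mem_index_enum.
  rewrite (_ : (_ <= 1) = true)//.
  apply: (@le_trans _ _ (\sum_(c < d) d%:R^-1 ^+ 2)).
    apply: ler_sum => c _; rewrite -real_normK ?num_real// lerXn2r ?nnegrE ?(ltW e0)//.
    by apply: H; rewrite mem_index_enum.
  rewrite sumr_const card_ord -(mulr_natl (d%:R^-1 ^+ 2)) expr2 mulrA divff ?mul1r//.
  by rewrite gt_eqF//; lra.
rewrite -has_predC => /hasP[c _ /= /negbTE cx].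
by rewrite (bigD1 c)//= {1}/f cx mul0r ler0n.
Qed.
End Volumes.

(** * Exponential moments of the forward pair count *)

Section ExponentialMoments.
Variables (R : realType) (d n : nat).
Let L := side R d n.

Definition shift (x : nat -> R) : nat -> R := fun i => x (d + i)%N.

(* In [pt] the index is computed with the semiring operations of [nat]. *)
Lemma ptE (x : nat -> R) j c : pt d x j c = x (j * d + c)%N.
Proof. by []. Qed.

Lemma pt_shift x j : pt d (shift x) j = pt d x j.+1.
Proof. by apply/funext => c; rewrite !ptE /shift mulSn addnA. Qed.

Lemma shift_glue (x y : nat -> R) : shift (glue d x y) = y.
Proof. by apply/funext => i; rewrite /shift /glue ltnNge leq_addr /= addKn. Qed.

Lemma pt_glue0 (x y : nat -> R) c : (c < d)%N -> pt d (glue d x y) 0 c = x c.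
Proof. by move=> cd; rewrite ptE /glue mul0n add0n cd. Qed.

Lemma eq_in_cube (a : nat -> R) s (p q : nat -> R) : (forall c, (c < d)%N -> p c = q c) ->
  in_cube d n a s p = in_cube d n a s q.
Proof. by move=> pq; apply: eq_forallb => c; rewrite pq. Qed.

Lemma eq_near_pt r (p p' q : nat -> R) : (forall c, (c < d)%N -> p c = p' c) ->
  near_pt d n r p q = near_pt d n r p' q.
Proof. by move=> pp'; rewrite /near_pt; under eq_bigr do rewrite pp'//. Qed.

Lemma measurable_pt (dT : measure_display) (T : measurableType dT)
    (f : T -> nat -> R) j : (forall i, measurable_fun setT (f ^~ i)) ->
  forall i, measurable_fun setT ((fun t => pt d (f t) j) ^~ i).
Proof. by move=> mf i; exact: mf. Qed.

Lemma measurable_shift (dT : measure_display) (T : measurableType dT)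
    (f : T -> nat -> R) : (forall i, measurable_fun setT (f ^~ i)) ->
  forall i, measurable_fun setT ((fun t => shift (f t)) ^~ i).
Proof. by move=> mf i; exact: mf. Qed.

Definition cube_count (a : nat -> R) s k (x : nat -> R) : R :=
  \sum_(i < k) (in_cube d n a s (pt d x i))%:R.

Variables (a : nat -> R) (s r D : R).

Definition near_count k (x : nat -> R) (p : nat -> R) : R :=
  \sum_(i < k) (near_pt d n r p (pt d x i) && in_cube d n a s (pt d x i))%:R.

(* Each point only counts its neighbours of larger index, because [iint]
   integrates the points with small index first. *)
Fixpoint forward_sum k (x : nat -> R) : R :=
  if k is k'.+1 then
    Num.min D (near_count k' (shift x) (pt d x 0)) + forward_sum k' (shift x)
  else 0.

Lemma cube_countS k x :
  cube_count a s k.+1 x = (in_cube d n a s (pt d x 0))%:R + cube_count a s k (shift x).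
Proof.
rewrite /cube_count big_ord_recl; congr (_ + _).
by apply: eq_bigr => i _; rewrite pt_shift.
Qed.

Lemma cube_count_ge0 k x : 0 <= cube_count a s k x.
Proof. by apply: sumr_ge0. Qed.

Lemma near_count_ge0 k x p : 0 <= near_count k x p.
Proof. by apply: sumr_ge0. Qed.

Lemma measurable_cube_count (dT : measure_display) (T : measurableType dT)
    (f : T -> nat -> R) k : (forall i, measurable_fun setT (f ^~ i)) ->
  measurable_fun setT (fun t => cube_count a s k (f t)).
Proof.
move=> mf; apply: measurable_sum => i; apply: measurable_in_cube.
exact: measurable_pt.
Qed.

Lemma measurable_forward_sum (dT : measure_display) (T : measurableType dT)
    (f : T -> nat -> R) k : (forall i, measurable_fun setT (f ^~ i)) ->
  measurable_fun setT (fun t => forward_sum k (f t)).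
Proof.
elim: k f => [|k IH] f mf //=.
apply: measurable_funD; last by apply: IH; exact: measurable_shift.
apply: measurable_minr => //; apply: measurable_sum => i.
under eq_fun do rewrite -mulnb natrM.
apply: measurable_funM.
  by apply: measurable_near_pt; [exact: measurable_pt|
    apply: measurable_pt; exact: measurable_shift].
by apply: measurable_in_cube; apply: measurable_pt; exact: measurable_shift.
Qed.

Lemma expR_le1DM (z : R) : expR z <= 1 + z * expR z.
Proof.
have := expR_ge1Dx (- z); rewrite expRN => H.
have := ler_wpM2r (expR_ge0 z) H; rewrite mulVf ?gt_eqF ?expR_gt0//.
by rewrite mulrDl mul1r mulNr; lra.
Qed.

Lemma expR_bool (b : bool) (t : R) : expR (t * b%:R) = 1 + (expR t - 1) * b%:R.
Proof. by case: b; rewrite ?mulr1 ?mulr0 ?expR0; lra. Qed.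

Hypotheses (L0 : 0 < L) (s0 : 0 <= s) (r0 : 0 < r) (D0 : 0 <= D).

Let v := unit_ball_vol R d * r ^+ d.
Let N := L ^+ d.

Lemma torus_side_le : - L / 2 <= L / 2.
Proof. by have := L0; generalize L => l l0; lra. Qed.

Lemma torus_side_sub : L / 2 - - L / 2 = L.
Proof. by generalize L => l; lra. Qed.

(** Truncation at [D] makes the exponential at most affine in the neighbour count. Integrating that
    count gives at most [v] for each later point in the cube, hence the linear term in
    [cube_count]. *)
Lemma one_point_bound (lam beta : R) k y : 0 <= lam -> 0 <= beta ->
  (iint (- L / 2) (L / 2) d (fun x => (expR
     (lam * Num.min D (near_count k y x) + beta * (in_cube d n a s x)%:R))%:E) <=
  (N + (expR beta - 1) * s ^+ d +
   expR beta * (lam * expR (lam * D)) * v * cube_count a s k y)%:E)%E.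
Proof.
move=> lam0 beta0; set kap := lam * expR (lam * D).
have kap0 : 0 <= kap by rewrite mulr_ge0// expR_ge0.
have eb1 : 0 <= expR beta - 1 by rewrite subr_ge0 -expR0 ler_expR.
pose c i : R := (in_cube d n a s (pt d y i))%:R.
pose F1 (x : nat -> R) : \bar R := (in_cube d n a s x)%:R%:E.
pose F2 (i : 'I_k) (x : nat -> R) : \bar R := (near_pt d n r x (pt d y i))%:R%:E.
have mF1 : vmeas F1.
  by move=> dT T f mf; apply/measurable_EFinP; exact: measurable_in_cube.
have mF2 i : vmeas (F2 i).
  by move=> dT T f mf; apply/measurable_EFinP; exact: measurable_near_pt.
have mcF2 (i : 'I_k) : vmeas (fun x => (c i)%:E * F2 i x)%E.
  by move=> dT T f mf; apply: measurable_funeM; exact: mF2.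
have mS : vmeas (fun x => \sum_(i < k) ((c i)%:E * F2 i x))%E.
  by move=> dT T f mf; apply: emeasurable_sum => i; exact: mcF2.
have S0 x : (0 <= \sum_(i < k) ((c i)%:E * F2 i x))%E.
  by apply: sume_ge0 => i _; rewrite mule_ge0// lee_fin.
apply: (@le_trans _ _ (iint (- L / 2) (L / 2) d (fun x =>
  (1%:E + ((expR beta - 1)%:E * F1 x +
    (expR beta * kap)%:E * \sum_(i < k) ((c i)%:E * F2 i x)))%E))).
  apply: le_iint => [x|x _]; first by rewrite lee_fin expR_ge0.
  have -> : (\sum_(i < k) ((c i)%:E * F2 i x) = (near_count k y x)%:E)%E.
    rewrite -sumEFin; apply: eq_bigr => i _.
    by rewrite /F2 /c -EFinM -natrM mulnb andbC.
  rewrite /F1 -!EFinM -!EFinD lee_fin expRD expR_bool.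
  set w := near_count k y x; set b := (in_cube d n a s x)%:R.
  have w0 : 0 <= w by exact: near_count_ge0.
  have /andP[b0 b1] : 0 <= b <= 1 by rewrite /b ler0n lern1 leq_b1.
  have m0 : 0 <= Num.min D w by rewrite le_min D0.
  have H : expR (lam * Num.min D w) <= 1 + kap * w.
    apply: le_trans (expR_le1DM _) _; rewrite lerD2l /kap -!mulrA ler_wpM2l//.
    rewrite mulrC ler_pM// ?expR_ge0// ?ge_min ?lexx ?orbT//.
    by rewrite ler_expR ler_wpM2l// ge_min lexx.
  have B0 : 0 <= 1 + (expR beta - 1) * b by rewrite addr_ge0// mulr_ge0.
  apply: le_trans (ler_wpM2r B0 H) _.
  (* In the expanded product only the cross term is estimated, by bounding the cube factor by
     [expR beta]; the main term stays exact. *)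
  have Hb : (expR beta - 1) * b <= (expR beta - 1) * 1 by rewrite ler_wpM2l.
  have kw0 : 0 <= kap * w by rewrite mulr_ge0.
  have : kap * w * (1 + (expR beta - 1) * b) <= kap * w * expR beta.
    by rewrite ler_wpM2l//; lra.
  by lra.
have e0 : 0 <= expR beta * kap by rewrite mulr_ge0// expR_ge0.
rewrite iintD//; last 2 first.
- by move=> x; rewrite adde_ge0// mule_ge0// lee_fin.
- move=> dT T f mf; apply: emeasurable_funD; apply: measurable_funeM.
    exact: mF1.
  exact: mS.
rewrite iintD//; last 4 first.
- by move=> x; rewrite mule_ge0// lee_fin.
- by move=> dT T f mf; apply: measurable_funeM; exact: mF1.
- by move=> x; rewrite mule_ge0// lee_fin.
- by move=> dT T f mf; apply: measurable_funeM; exact: mS.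
rewrite !iintZl//; last by move=> x; rewrite lee_fin.
rewrite (@iint_sum _ _ _ _ _ _ (fun (i : 'I_k) x => (c i)%:E * F2 i x)%E)//; last by move=> i x; rewrite mule_ge0// lee_fin.
rewrite iint_cst ?torus_side_le// torus_side_sub.
rewrite mul1r -/N -addrA !EFinD leeD2l// leeD//.
  by rewrite EFinM lee_wpmul2l ?lee_fin//; exact: iint_in_cube.
rewrite -(mulrA _ v) [leRHS]EFinM lee_wpmul2l ?lee_fin// mulr_sumr -sumEFin.
apply: lee_sum => i _; rewrite iintZl//; last by move=> x; rewrite lee_fin.
by rewrite (mulrC v) [leRHS]EFinM lee_wpmul2l ?lee_fin//; exact: iint_near_pt.
Qed.

(** Point [0] is integrated innermost and enters only the first summands of [forward_sum] and
    [cube_count], so the rest of the exponential factors out. The constant [C] collects factors in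
    the inductions below. *)
Lemma iint_expR_peel (lam beta C : R) k : 0 <= lam -> 0 <= beta -> 0 <= C ->
  (iint (- L / 2) (L / 2) (k.+1 * d) (fun x =>
     (C * expR (lam * forward_sum k.+1 x + beta * cube_count a s k.+1 x))%:E) <=
   iint (- L / 2) (L / 2) (k * d) (fun y =>
     (C * expR (lam * forward_sum k y + beta * cube_count a s k y) *
      (N + (expR beta - 1) * s ^+ d +
       expR beta * (lam * expR (lam * D)) * v * cube_count a s k y))%:E))%E.
Proof.
move=> lam0 beta0 C0; rewrite mulSn iint_glue; apply: le_iint => [y|y _].
  by apply: iint_ge0 => x; rewrite lee_fin mulr_ge0// expR_ge0.
have E0 : 0 <= C * expR (lam * forward_sum k y + beta * cube_count a s k y).
  by rewrite mulr_ge0// expR_ge0.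
apply: (@le_trans _ _ (iint (- L / 2) (L / 2) d (fun x =>
  (C * expR (lam * forward_sum k y + beta * cube_count a s k y))%:E *
  (expR (lam * Num.min D (near_count k y x) + beta * (in_cube d n a s x)%:R))%:E)%E)).
  apply: le_iint => [x|x _]; first by rewrite lee_fin mulr_ge0// expR_ge0.
  rewrite -EFinM lee_fin -mulrA -expRD /= cube_countS shift_glue.
  rewrite (@eq_in_cube a s _ x); last by move=> c; exact: pt_glue0.
  have -> : near_count k y (pt d (glue d x y) 0) = near_count k y x.
    apply: eq_bigr => i _; rewrite (@eq_near_pt r _ x)//.
    by move=> c; exact: pt_glue0.
  by rewrite ler_wpM2l// ler_expR; lra.
rewrite iintZl//; last first.
  move=> dT T f mf; apply/measurable_EFinP; apply: measurableT_comp => //.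
  apply: measurable_funD; apply: measurable_funM => //.
    apply: measurable_minr => //; apply: measurable_sum => i.
    under eq_fun do rewrite -mulnb natrM.
    by apply: measurable_funM => //; exact: measurable_near_pt.
  exact: measurable_in_cube.
by rewrite [leRHS]EFinM lee_wpmul2l ?lee_fin//; exact: one_point_bound.
Qed.

(** For [lam = 0] the factor produced by peeling is constant, so [k] peelings give its power. *)
Lemma iint_expR_cube_count (beta C : R) k : 0 <= beta -> 0 <= C ->
  (iint (- L / 2) (L / 2) (k * d) (fun x => (C * expR (beta * cube_count a s k x))%:E)
   <= (C * (N + (expR beta - 1) * s ^+ d) ^+ k)%:E)%E.
Proof.
move=> beta0; elim: k C => [|k IH] C C0.
  by rewrite mul0n /= /cube_count big_ord0 mulr0 expR0.
have eb1 : 0 <= expR beta - 1 by rewrite subr_ge0 -expR0 ler_expR.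
have X0 : 0 <= N + (expR beta - 1) * s ^+ d.
  by rewrite addr_ge0 ?mulr_ge0 ?exprn_ge0// ltW.
apply: (@le_trans _ _ (iint (- L / 2) (L / 2) (k.+1 * d) (fun x =>
  (C * expR (0 * forward_sum k.+1 x + beta * cube_count a s k.+1 x))%:E))).
  apply: le_iint => [x|x _]; first by rewrite lee_fin mulr_ge0// expR_ge0.
  by rewrite mul0r add0r.
apply: le_trans (iint_expR_peel _ _ _ _) _ => //.
have CX0 : 0 <= C * (N + (expR beta - 1) * s ^+ d) by rewrite mulr_ge0.
rewrite exprS [in leRHS]mulrA; apply: le_trans (IH _ CX0).
apply: le_iint => [x|x _].
  by rewrite lee_fin !mul0r mulr0 !mul0r addr0 mulr_ge0// mulr_ge0// expR_ge0.
by rewrite !mul0r mulr0 !mul0r addr0 add0r mulrAC.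
Qed.

(** Each peeling raises the tilt of [cube_count] by at most [q]; summing the tilts [beta + j * q]
    for [j < k] gives at most [k * beta + q * k ^ 2 / 2]. The last hypothesis keeps every tilt below
    [eta], so that one constant [expR eta] serves all steps. *)
Lemma iint_expR_forward_sum (lam beta eta C : R) k
    (q := expR eta * (lam * expR (lam * D)) * v / N) :
  0 <= lam -> 0 <= beta -> 0 <= C -> 0 <= v -> beta + q * k%:R <= eta ->
  (iint (- L / 2) (L / 2) (k * d) (fun x =>
     (C * expR (lam * forward_sum k x + beta * cube_count a s k x))%:E)
   <= (C * N ^+ k * expR (expR eta * s ^+ d / N * (k%:R * beta + q * k%:R ^+ 2 / 2)))%:E)%E.
Proof.
move=> lam0 beta0 C0 v0.
have N0 : 0 < N by exact: exprn_gt0.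
have q0 : 0 <= q by rewrite /q divr_ge0 ?(ltW N0)// mulr_ge0// mulr_ge0 ?expR_ge0// mulr_ge0 ?expR_ge0.
have V0 : 0 <= s ^+ d by exact: exprn_ge0.
elim: k beta C beta0 C0 => [|k IH] beta C beta0 C0 beta_le.
  rewrite mul0n /= /cube_count big_ord0 !mulr0 addr0 expR0 lee_fin !mulr1.
  by rewrite !mul0r expr0n /= mulr0 mul0r addr0 mulr0 expR0 mulr1.
have qk0 : 0 <= q * k%:R by rewrite mulr_ge0.
have beta_eta : beta <= eta.
  by move: beta_le; rewrite -natr1 mulrDr mulr1; lra.
apply: le_trans (iint_expR_peel _ lam0 beta0 C0) _.
pose C' := C * (N * expR (expR eta * s ^+ d / N * beta)).
have C'0 : 0 <= C' by rewrite mulr_ge0// mulr_ge0 ?expR_ge0// ltW.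
apply: (@le_trans _ _ (iint (- L / 2) (L / 2) (k * d) (fun x =>
   (C' * expR (lam * forward_sum k x + (beta + q) * cube_count a s k x))%:E))).
  apply: le_iint => [y|y _].
    have eb1 : 0 <= expR beta - 1 by rewrite subr_ge0 -expR0 ler_expR.
    rewrite lee_fin mulr_ge0 ?(mulr_ge0 C0) ?expR_ge0//.
    rewrite addr_ge0//; first by rewrite addr_ge0 ?(ltW N0)// mulr_ge0.
    rewrite mulr_ge0 ?cube_count_ge0// mulr_ge0// mulr_ge0 ?expR_ge0//.
    by rewrite mulr_ge0 ?expR_ge0.
  set c := cube_count a s k y; have c0 : 0 <= c by exact: cube_count_ge0.
  rewrite lee_fin /C' (mulrDl beta q c) (addrA _ _ (q * c)) (expRD _ (q * c)).
  set E := expR (lam * _ + _); set X := expR (_ * beta).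
  have -> : C * (N * X) * (E * expR (q * c)) = C * E * (N * (X * expR (q * c))) by ring.
  rewrite ler_wpM2l ?mulr_ge0 ?expR_ge0// /X -expRD.
  (* [1 + z <= expR z] turns the affine factor into an exponential linear in [c], which is again of
     the form treated by the induction. *)
  apply: le_trans (ler_wpM2l (ltW N0) (expR_ge1Dx _)).
  rewrite !mulrDr mulr1 addrA; apply: lerD; [rewrite lerD2l|].
    have -> : N * (expR eta * s ^+ d / N * beta) = beta * expR eta * s ^+ d.
      by field; rewrite gt_eqF.
    rewrite ler_wpM2r//.
    have := expR_le1DM beta; have : beta * expR beta <= beta * expR eta.
      by rewrite ler_wpM2l// ler_expR.
    by lra.
  have -> : N * (q * c) = expR eta * (lam * expR (lam * D)) * v * c.
    by rewrite /q; field; rewrite gt_eqF.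
  rewrite !ler_wpM2r// ?ler_expR//.
  by rewrite mulr_ge0// expR_ge0.
apply: le_trans (IH _ _ _ C'0 _) _.
- by rewrite addr_ge0.
- by move: beta_le; rewrite -natr1 mulrDr mulr1; lra.
rewrite lee_fin /C'; set X := expR eta * s ^+ d / N; set Y := expR (X * (k%:R * _ + _)).
have X0 : 0 <= X by rewrite divr_ge0 ?(ltW N0)// mulr_ge0 ?expR_ge0.
have -> : C * (N * expR (X * beta)) * N ^+ k * Y = C * N ^+ k.+1 * (expR (X * beta) * Y).
  by rewrite exprS; ring.
rewrite ler_wpM2l ?mulr_ge0 ?exprn_ge0 ?(ltW N0) ?(ltW L0)// /Y -expRD ler_expR -mulrDr.
rewrite ler_wpM2l// -(natr1 k); move: q0; generalize q => q' q'0; lra.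
Qed.
End ExponentialMoments.

(** * Torus geometry, the unit grid, and degree sums *)

Section TorusGeometry.
Variable R : realType.
Implicit Types L x y z u : R.

(** [tmod L z] is the least nonnegative representative of [z] modulo [L]. *)
Lemma tmod_le L z u (j : int) : 0 < L -> z = u + L * j%:~R -> 0 <= u -> tmod L z <= u.
Proof.
move=> L0 -> u0; rewrite /tmod.
have : (j <= Num.floor ((u + L * j%:~R) / L))%R.
  rewrite floor_ge_int mulrDl mulrAC divff ?gt_eqF// mul1r lerDr.
  by rewrite divr_ge0// ltW.
rewrite -(ler_int R) => H.
have : L * j%:~R <= L * (Num.floor ((u + L * j%:~R) / L))%:~R by rewrite ler_wpM2l// ltW.
by lra.
Qed.

Lemma tdist1_witness L x y : 0 < L ->
  exists j : int, `|x - y + L * j%:~R| <= tdist1 L x y.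
Proof.
move=> L0; have /andP[t0 tL] := tmod_ge0_lt (x - y) L0.
rewrite /tdist1 /Num.min; case: ifP => _.
  exists (- Num.floor ((x - y) / L)).
  by rewrite mulrNz mulrN ger0_norm.
exists (- Num.floor ((x - y) / L) - 1).
have -> : x - y + L * (- Num.floor ((x - y) / L) - 1)%:~R = - (L - tmod L (x - y)).
  by rewrite /tmod intrD mulrNz /=; ring.
by rewrite normrN ger0_norm// subr_ge0 ltW.
Qed.

Lemma tmodN L z : 0 < L -> tmod L z != 0 -> tmod L (- z) = L - tmod L z.
Proof.
move=> L0 tn0; have /andP[t0 tL] := tmod_ge0_lt z L0.
have {t0} t0 : 0 < tmod L z by rewrite lt_neqAle eq_sym tn0.
have e : - z - L * (- Num.floor (z / L) - 1)%:~R = L - tmod L z.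
  by rewrite /tmod intrD mulrNz /=; ring.
have H : 0 <= - z - L * (- Num.floor (z / L) - 1)%:~R < L.
  by rewrite e; apply/andP; split; lra.
by rewrite (tmod_uniq L0 H).
Qed.

Lemma tdist1C L x y : 0 < L -> tdist1 L x y = tdist1 L y x.
Proof.
move=> L0; rewrite /tdist1 -(opprB x y).
have [t0|tn0] := eqVneq (tmod L (x - y)) 0; last first.
  by rewrite tmodN// minC; congr (Num.min _ _); ring.
suff -> : tmod L (- (x - y)) = 0 by rewrite t0.
have e : - (x - y) - L * (- Num.floor ((x - y) / L))%:~R = 0.
  by move: t0; rewrite /tmod mulrNz mulrN => t0; lra.
have H : 0 <= - (x - y) - L * (- Num.floor ((x - y) / L))%:~R < L by rewrite e lexx.
by rewrite (tmod_uniq L0 H).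
Qed.

Variables (d n : nat).
Hypothesis L0 : 0 < side R d n.

Lemma near_ptC r (p q : nat -> R) : near_pt d n r p q = near_pt d n r q p.
Proof. by rewrite /near_pt; under eq_bigr do rewrite tdist1C//. Qed.

Lemma near_pt_coord r (p q : nat -> R) (c : 'I_d) : 0 <= r ->
  near_pt d n r p q -> tdist1 (side R d n) (p c) (q c) <= r.
Proof.
move=> r0 pq; apply: (@le_trans _ _ `|tdist1 (side R d n) (p c) (q c)|).
  exact: ler_norm.
rewrite -(@ler_pXn2r _ 2)// ?nnegrE// real_normK ?num_real//.
apply: le_trans pq; rewrite (bigD1 c)//= lerDl.
by apply: sumr_ge0 => i _; rewrite sqr_ge0.
Qed.

(** In each coordinate, the offset of [q] plus a displacement in [[-r, r]] plus [r] is a nonnegative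
    representative of the offset of [p] in the enlarged cube, so [tmod_le] applies. *)
Lemma in_cube_near (a : nat -> R) s r (p q : nat -> R) : 0 <= r ->
  near_pt d n r p q -> in_cube d n a s q ->
  in_cube d n (fun c => a c - r) (s + r *+ 2) p.
Proof.
move=> r0 pq /forallP qa; apply/forallP => c.
have [j pqj] := tdist1_witness (p c) (q c) L0.
have {}pqj := le_trans pqj (near_pt_coord c r0 pq).
move: pqj; rewrite ler_norml => /andP[l1 l2].
have /andP[t0 _] := tmod_ge0_lt (q c - a c) L0; have ts := qa c.
set t := tmod _ (q c - a c) in t0 ts.
apply: (@le_trans _ _ (t + (p c - q c + side R d n * j%:~R) + r)); last first.
  by rewrite mulr2n; lra.
apply: (@tmod_le _ _ _ (Num.floor ((q c - a c) / side R d n) - j))%R => //.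
  by rewrite /t /tmod intrB; ring.
by lra.
Qed.

Lemma in_cube_widen (a : nat -> R) s r (p : nat -> R) : 0 <= r ->
  in_cube d n a s p -> in_cube d n (fun c => a c - r) (s + r *+ 2) p.
Proof.
move=> r0 /forallP pa; apply/forallP => c.
have /andP[t0 _] := tmod_ge0_lt (p c - a c) L0; have ts := pa c.
set t := tmod _ (p c - a c) in t0 ts.
apply: (@le_trans _ _ (t + r)); last by rewrite mulr2n; lra.
apply: (@tmod_le _ _ _ (Num.floor ((p c - a c) / side R d n)))%R => //.
  by rewrite /t /tmod; ring.
by lra.
Qed.

(** The successor provides the last partial cell and, for an integer side, the upper face. *)
Definition grid_size : nat := (Num.trunc (side R d n)).+1.

(** The default index [0] concerns only coordinates [c >= d], which [in_cube] does not read. *)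
Definition grid_corner (g : {ffun 'I_d -> 'I_grid_size}) (c : nat) : R :=
  - side R d n / 2 + (oapp (fun o => nat_of_ord (g o)) 0%N (insub c))%:R.

Lemma in_grid_cube (p : nat -> R) :
  (forall c, (c < d)%N -> - side R d n / 2 <= p c <= side R d n / 2) ->
  exists g, in_cube d n (grid_corner g) 1 p.
Proof.
move=> pbox; set L := side R d n in pbox *.
have tr (c : 'I_d) : (Num.trunc (p c + L / 2) < grid_size)%N.
  have /andP[p1 p2] := pbox c (ltn_ord c).
  by rewrite ltnS le_truncn// -/L; lra.
exists [ffun c => Ordinal (tr c)]; apply/forallP => c.
have /andP[p1 p2] := pbox c (ltn_ord c).
have p0 : 0 <= p c + L / 2 by lra.
have /andP[q1 q2] := truncn_itv p0.
rewrite /grid_corner valK /= ffunE /= -/L.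
rewrite -[X in _ < X]natr1 in q2.
apply: (@le_trans _ _ (p c + L / 2 - (Num.trunc (p c + L / 2))%:R)); last by lra.
by apply: (@tmod_le _ _ _ 0) => //; lra.
Qed.

(** Replaces a neighbour bound at every possible centre [p] by a bound for finitely many enlarged
    grid cubes. *)
Lemma near_pt_count_le r k (x : nat -> R) (p : nat -> R) g : 0 <= r ->
  in_cube d n (grid_corner g) 1 p ->
  \sum_(i < k) (near_pt d n r p (pt d x i))%:R <=
  cube_count d n (fun c => grid_corner g c - r) (1 + r *+ 2) k x.
Proof.
move=> r0 pg; apply: ler_sum => i _; rewrite ler_nat.
case: (boolP (near_pt _ _ _ _ _)) => // pi.
by rewrite (@in_cube_near _ _ _ _ p)// near_ptC.
Qed.

Lemma tdist_le_near_pt r (x : nat -> R) i j : 0 <= r ->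
  (tdist d n x i j <= r) = near_pt d n r (pt d x i) (pt d x j).
Proof.
move=> r0; rewrite /tdist /near_pt; set S := \sum_(c < d) _.
have S0 : 0 <= S by apply: sumr_ge0 => c _; rewrite sqr_ge0.
by rewrite -(@ler_pXn2r _ 2)// ?nnegrE ?sqrtr_ge0// sqr_sqrtr.
Qed.

Variables (r D s : R) (a : nat -> R).
Hypothesis r0 : 0 <= r.

Let deg_ind (x : nat -> R) (j i : nat) : R :=
  [&& in_cube d n a s (pt d x j), j != i & near_pt d n r (pt d x j) (pt d x i)]%:R.

Lemma cube_degsumE k (x : nat -> R) :
  (cube_degsum d n r a s k x)%:R = \sum_(j < k) \sum_(i < k) deg_ind x j i.
Proof.
rewrite /cube_degsum natr_sum big_mkcond; apply: eq_bigr => j _.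
case: ifPn => jB; last first.
  by rewrite big1// => i _; rewrite /deg_ind (negbTE jB).
rewrite /degree -sum1_card natr_sum big_mkcond /=; apply: eq_bigr => i _.
have -> : (i \in [set i | adj d n r k x j i]%classic) = adj d n r k x j i.
  by apply/idP/idP => [/set_mem|adj_ji]//; exact: mem_set.
rewrite /adj /deg_ind jB tdist_le_near_pt//= -(inj_eq val_inj) /=.
by case: ifP.
Qed.

(** Removing point [0] deletes one row and one column of the adjacency array, and each is at most
    the number of neighbours of point [0] in the enlarged cube. This is the source of the factor
    [2]; [near_D] makes the truncation inactive. *)
Lemma cube_degsum_forward k (x : nat -> R) :
  (forall j, (j < k)%N ->
     \sum_(i < k) (near_pt d n r (pt d x j) (pt d x i))%:R <= D) ->
  (cube_degsum d n r a s k x)%:R <=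
  2 * forward_sum d n (fun c => a c - r) (s + r *+ 2) r D k x.
Proof.
rewrite cube_degsumE; elim: k x => [|k IH] x near_D.
  by rewrite big_ord0 /= mulr0.
pose x' := shift d x.
have degS j i : deg_ind x j.+1 i.+1 = deg_ind x' j i.
  by rewrite /deg_ind !pt_shift eqSS.
have {}IH : \sum_(j < k) \sum_(i < k) deg_ind x' j i <=
  2 * forward_sum d n (fun c => a c - r) (s + r *+ 2) r D k x'.
  apply: IH => j jk; apply: le_trans (near_D j.+1 _) => //.
  rewrite big_ord_recl /= -[leLHS]add0r lerD//.
  by apply: ler_sum => i _; rewrite !pt_shift.
pose w := near_count d n (fun c => a c - r) (s + r *+ 2) r k x' (pt d x 0).
have wD : w <= D.
  apply: le_trans (near_D 0%N _) => //.
  rewrite big_ord_recl /= -[leLHS]add0r lerD//.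
  by apply: ler_sum => i _; rewrite pt_shift ler_nat; case: (near_pt _ _ _ _ _); case: in_cube.
rewrite /= -/x' -/w (min_idPr wD) mulrDr.
under eq_bigr do rewrite big_ord_recl.
rewrite big_split /= big_ord_recl [X in _ + X <= _]big_ord_recl /=.
have -> : deg_ind x 0 0 = 0 by rewrite /deg_ind eqxx andbF.
rewrite add0r addrA lerD//; last first.
  by under eq_bigr do under eq_bigr do rewrite degS.
have le_bool (b1 b2 : bool) : (b1 -> b2) -> (b1 <= b2)%N.
  by case: b1; case: b2 => // /(_ isT).
rewrite mulr_natl mulr2n /w /near_count.
(* First the column: the other endpoint lies in the cube itself. Then the row: point [0] lies in the
   cube, and its neighbour in the enlargement. *)
apply: lerD; apply: ler_sum => i _; rewrite pt_shift ler_nat; apply: le_bool.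
  move=> /andP[iB /andP[_ i0]].
  by rewrite near_ptC; apply/andP; split; [exact: i0|exact: in_cube_widen].
move=> /andP[B0 /andP[_ i0]]; apply/andP; split; first exact: i0.
by apply: (in_cube_near (q := pt d x 0)) => //; rewrite near_ptC; exact: i0.
Qed.
End TorusGeometry.

(** * Markov and union bounds for a fixed number of points *)

Section FixedNumberOfPoints.
Variables (R : realType) (d n k : nat).
Let L := side R d n.
Let N := L ^+ d.
Hypothesis L0 : 0 < L.

Variables (m : nat) (corner : 'I_m -> nat -> R) (s r D t lam eta thr : R).
Hypotheses (s0 : 0 <= s) (r0 : 0 < r) (D0 : 0 <= D) (t0 : 0 <= t) (lam0 : 0 <= lam).

Let good (x : nat -> R) : bool :=
  [forall i : 'I_m, (cube_degsum d n r (corner i) s k x)%:R < 2 * thr].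
Let grid := {ffun 'I_d -> 'I_(grid_size R d n)}.
Let Fgrid (g : grid) (x : nat -> R) : R :=
  expR (- (t * D)) *
  expR (t * cube_count d n (fun c => grid_corner g c - r) (1 + r *+ 2) k x).
(** The summand with factor [0] is the initial tilt [beta = 0] of [iint_expR_forward_sum]. *)
Let Fcube (i : 'I_m) (x : nat -> R) : R :=
  expR (- (lam * thr)) *
  expR (lam * forward_sum d n (fun c => corner i c - r) (s + r *+ 2) r D k x +
        0 * cube_count d n (fun c => corner i c - r) (s + r *+ 2) k x).

(** Pointwise Markov and union bound: if the event fails, either some enlarged grid cube holds at
    least [D] points and its [Fgrid] is at least [1], or truncation is inactive, some forward sum
    reaches [thr] and its [Fcube] is at least [1]. *)
Lemma good_or_exceptional (x : nat -> R) : in_box (- L / 2) (L / 2) (k * d) x ->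
  1 <= (good x)%:R + (\sum_g Fgrid g x + \sum_i Fcube i x).
Proof.
move=> xbox.
have Fg0 g : 0 <= Fgrid g x by rewrite mulr_ge0 ?expR_ge0.
have Fc0 i : 0 <= Fcube i x by rewrite mulr_ge0 ?expR_ge0.
have Sg0 : 0 <= \sum_g Fgrid g x by apply: sumr_ge0.
have Sc0 : 0 <= \sum_i Fcube i x by apply: sumr_ge0.
have [goodx|] := boolP (good x); first by rewrite lerDl addr_ge0.
rewrite negb_forall => /existsP[i]; rewrite -leNgt => thr_le; rewrite add0r.
pose cnt (g : grid) := cube_count d n (fun c => grid_corner g c - r) (1 + r *+ 2) k x.
have [/existsP[g Dg]|/existsPn noD] := boolP [exists g : grid, D <= cnt g].
  apply: (@le_trans _ _ (Fgrid g x)); last first.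
    by rewrite (bigD1 g)//= -addrA lerDl addr_ge0//; apply: sumr_ge0.
  by rewrite /Fgrid -expRD -[leLHS]expR0 ler_expR addrC subr_ge0 ler_wpM2l.
apply: (@le_trans _ _ (Fcube i x)); last first.
  by rewrite (bigD1 i)//= addrCA lerDl addr_ge0//; apply: sumr_ge0.
rewrite /Fcube -expRD -[leLHS]expR0 ler_expR mul0r addr0 addrC subr_ge0 ler_wpM2l//.
rewrite -(@ler_pM2l _ 2)//; apply: le_trans thr_le _.
apply: cube_degsum_forward => // [|j jk]; first exact: ltW.
have [g xg] : exists g, in_cube d n (@grid_corner R d n g) 1 (pt d x j).
  apply: in_grid_cube => // c cd; apply: xbox.1.
  rewrite -[(_ + _)%R]/(j * d + c)%N.
  by apply: (@leq_trans (j.+1 * d)); rewrite ?leq_mul2r ?jk ?orbT// mulSn addnC ltn_add2r.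
apply: le_trans (near_pt_count_le _ _ _ (ltW r0) xg) _ => //.
by apply: ltW; rewrite ltNge; exact: noD.
Qed.

Let q := expR eta * (lam * expR (lam * D)) * (unit_ball_vol R d * r ^+ d) / N.

Lemma iint_good_ge : (0 < d)%N -> q * k%:R <= eta ->
  ((N ^+ k)%:E <= iint (- L / 2) (L / 2) (k * d) (fun x => (good x)%:R%:E) +
    (#|grid|%:R * (expR (- (t * D)) * (N + (expR t - 1) * (1 + r *+ 2) ^+ d) ^+ k) +
     m%:R * (expR (- (lam * thr)) * N ^+ k *
       expR (expR eta * (s + r *+ 2) ^+ d / N * (q * k%:R ^+ 2 / 2))))%:E)%E.
Proof.
move=> d0 qk.
have r20 : 0 <= r *+ 2 by rewrite mulrn_wge0// ltW.
have v0 : 0 <= unit_ball_vol R d * r ^+ d.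
  by rewrite mulr_ge0 ?exprn_ge0 ?(ltW r0)// ltW// unit_ball_vol_gt0.
have Fg0 g x : 0 <= Fgrid g x by rewrite mulr_ge0 ?expR_ge0.
have Fc0 i x : 0 <= Fcube i x by rewrite mulr_ge0 ?expR_ge0.
have mFg g : vmeas (fun x => (Fgrid g x)%:E).
  move=> dT T f mf; apply/measurable_EFinP; apply: measurable_funM => //.
  apply: measurableT_comp => //; apply: measurable_funM => //.
  exact: measurable_cube_count.
have mFc i : vmeas (fun x => (Fcube i x)%:E).
  move=> dT T f mf; apply/measurable_EFinP; apply: measurable_funM => //.
  apply: measurableT_comp => //; apply: measurable_funD; apply: measurable_funM => //.
    exact: measurable_forward_sum.
  exact: measurable_cube_count.
pose G (x : nat -> R) := (\sum_g (Fgrid g x)%:E + \sum_i (Fcube i x)%:E)%E.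
have GE x : G x = (\sum_g Fgrid g x + \sum_i Fcube i x)%:E by rewrite /G EFinD -!sumEFin.
have mSg : vmeas (fun x => \sum_g (Fgrid g x)%:E)%E.
  by move=> dT T f mf; apply: emeasurable_sum => g; exact: mFg.
have mSc : vmeas (fun x => \sum_i (Fcube i x)%:E)%E.
  by move=> dT T f mf; apply: emeasurable_sum => i; exact: mFc.
have mG : vmeas G.
  by move=> dT T f mf; apply: emeasurable_funD; [exact: mSg|exact: mSc].
have Sg0 x : (0 <= \sum_g (Fgrid g x)%:E)%E by apply: sume_ge0 => g _; rewrite lee_fin.
have Sc0 x : (0 <= \sum_i (Fcube i x)%:E)%E by apply: sume_ge0 => i _; rewrite lee_fin.
have G0 x : (0 <= G x)%E by rewrite adde_ge0.
(* A measurable function below the indicator of the good event: additivity is applied to [h] and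
   [G], and the event enters by monotonicity alone. *)
pose h (x : nat -> R) := maxe 0%E (1 - G x)%E.
have h0 x : (0 <= h x)%E by rewrite le_max lexx.
have mh : vmeas h.
  by move=> dT T f mf; apply: measurable_maxe => //; apply: emeasurable_funB => //; exact: mG.
have LL : - L / 2 <= L / 2 by exact: torus_side_le.
have NE : N ^+ k = L ^+ (k * d) by rewrite /N -exprM mulnC.
apply: (@le_trans _ _ (iint (- L / 2) (L / 2) (k * d) (fun x => (h x + G x)%E))).
  have <- : iint (- L / 2) (L / 2) (k * d) (fun=> 1%:E) = (N ^+ k)%:E.
    by rewrite iint_cst// mul1r NE; congr (_ ^+ _)%:E; exact: torus_side_sub.
  apply: le_iint => [x|x _]; first by rewrite lee_fin.
  have hG : ((1 - G x) + G x <= h x + G x)%E by rewrite leeD2r// le_max lexx orbT.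
  apply: le_trans hG; rewrite subeK// GE//.
rewrite iintD//; apply: leeD.
  apply: le_iint => // x xbox; rewrite ge_max lee_fin ler0n /=.
  have := good_or_exceptional xbox; rewrite GE -EFinB lee_fin.
  by move=> H; rewrite lerBlDr.
rewrite iintD// EFinD; apply: leeD.
  rewrite (@iint_sum _ _ _ _ _ _ (fun g x => (Fgrid g x)%:E))//.
  rewrite -sum1_card natr_sum mulr_suml -sumEFin; apply: lee_sum => g _; rewrite mul1r.
  have s1 : 0 <= 1 + r *+ 2 by rewrite addr_ge0.
  exact: (iint_expR_cube_count _ L0 s1 r0 D0 k t0 (expR_ge0 _)).
rewrite (@iint_sum _ _ _ _ _ _ (fun i x => (Fcube i x)%:E))//.
rewrite -[in m%:R](card_ord m) -sum1_card natr_sum mulr_suml -sumEFin; apply: lee_sum => i _.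
have s1 : 0 <= s + r *+ 2 by rewrite addr_ge0.
have qk1 : 0 + q * k%:R <= eta by rewrite add0r.
have := iint_expR_forward_sum (fun c => corner i c - r) L0 s1 r0 D0 lam0 (lexx 0)
  (expR_ge0 (- (lam * thr))) v0 qk1.
by rewrite mul1r mulr0 add0r.
Qed.
End FixedNumberOfPoints.

(** * Elementary asymptotics and the exponential series *)

Section Asymptotics.
Variable R : realType.

Lemma side_gt0 d n : (0 < n)%N -> 0 < side R d n.
Proof. by move=> n0; rewrite powR_gt0// ltr0n. Qed.

Lemma powR_invnX d (x : R) : (0 < d)%N -> 0 <= x -> (x `^ d%:R^-1) ^+ d = x.
Proof.
move=> d0 x0; rewrite -powR_mulrn ?powR_ge0// -powRrM mulVf ?powRr1//.
by rewrite pnatr_eq0 -lt0n.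
Qed.

Lemma side_exprn d n : (0 < d)%N -> side R d n ^+ d = n%:R.
Proof. by move=> d0; exact: powR_invnX. Qed.

Lemma nneseries_expR (c z : R) : 0 <= c -> 0 <= z ->
  (\sum_(k <oo) (c * (z ^+ k / k`!%:R))%:E = (c * expR z)%:E)%E.
Proof.
move=> c0 z0.
have t0 (k : nat) : (0 <= (z ^+ k / k`!%:R)%:E)%E.
  by rewrite lee_fin divr_ge0// exprn_ge0.
under eq_eseriesr do rewrite EFinM.
rewrite nneseriesZl//.
rewrite EFinM; congr (_ * _)%E.
transitivity (limn (EFin \o series (exp_coeff z)))%E.
  by congr (limn _); apply/funext => k /=; rewrite /series /= sumEFin.
exact: EFin_lim (is_cvg_series_exp_coeff z).
Qed.

Lemma r_giant_ge0 d : 0 <= r_giant R d.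
Proof.
rewrite /r_giant; set S := (X in inf X).
(* The infimum of the empty set is [0] by convention. *)
have [->|/set0P S0] := eqVneq S set0; first by rewrite inf0.
by apply: lb_le_inf => // r [/ltW].
Qed.

Lemma ln_ge_near (M : R) : \forall n \near \oo, M <= ln (n%:R : R).
Proof.
near=> n; rewrite -[leLHS]expRK ler_ln ?posrE ?expR_gt0//; last first.
  by rewrite ltr0n; near: n; exact: nbhs_infty_gt.
by near: n; exact: nbhs_infty_ger.
Unshelve. all: by end_near. Qed.

(** With [s ^+ d = l ^+ 2], the enlargement costs [(1 + 2c/s)^d <= exp(2cd/s)], which is at most
    [expR eta] once [s >= 2cd/eta]. *)
Lemma enlarged_cube_le (d : nat) (l c eta : R) : (0 < d)%N -> 0 < eta -> 0 <= c ->
  1 <= l -> (c *+ 2 * d%:R / eta) ^+ d <= l ->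
  (l `^ (2 / d%:R) + c *+ 2) ^+ d <= expR eta * l ^+ 2.
Proof.
move=> d0 eta0 c0 l1 Ml; set s := l `^ _.
have dR : 0 < d%:R :> R by rewrite ltr0n.
have s0 : 0 < s by rewrite powR_gt0//; lra.
have sd : s ^+ d = l ^+ 2.
  rewrite -powR_mulrn ?(ltW s0)// -powRrM mulrAC -mulrA divff ?gt_eqF// mulr1.
  by rewrite powR_mulrn//; lra.
have c20 : 0 <= c *+ 2 by rewrite mulrn_wge0.
have Ms : c *+ 2 * d%:R / eta <= s.
  rewrite -(@ler_pXn2r _ d)// ?nnegrE ?(ltW s0)//; last first.
    by rewrite divr_ge0 ?(ltW eta0)// mulr_ge0.
  by rewrite sd (le_trans Ml)// ler_eXnr.
have -> : s + c *+ 2 = s * (1 + c *+ 2 / s).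
  by rewrite mulrDr mulr1 mulrCA divff ?mulr1// gt_eqF.
rewrite exprMn sd mulrC ler_wpM2r ?sqr_ge0//.
apply: (@le_trans _ _ (expR (c *+ 2 / s) ^+ d)).
  rewrite lerXn2r ?nnegrE ?expR_ge0 ?expR_ge1Dx// addr_ge0// divr_ge0//.
  exact: ltW.
rewrite -expRM_natl ler_expR mulrCA mulrA ler_pdivrMr//.
by move: Ms; rewrite ler_pdivrMr// mulrC [X in _ <= X -> _]mulrC.
Qed.
End Asymptotics.

(** * Explicit constants and the Poisson average *)

Section UniformBound.
Variables (R : realType) (d : nat) (rmin rmax : R).
Hypotheses (d0 : (0 < d)%N) (rmin0 : 0 < rmin).

(** Each source of loss is allowed a factor [expR eta = 11 / 10]. *)
Let eta : R := ln (11 / 10).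
Let vmin : R := unit_ball_vol R d * rmin ^+ d.
Let vmax : R := unit_ball_vol R d * rmax ^+ d.
(* With [lam = tilt / ln n] the exponent [lam * v * ln n ^+ 2] in Markov's
   inequality is at least [20 * ln n], and a tenth of it beats the union bound
   over the [2 ^ d * n] cubes. *)
Let tilt : R := 20 / vmin.
(** Chosen so that [t * D = 2 * ln n] for the truncation level [D = eta / tilt * ln n]; each grid
    cube then costs order [n^-2]. *)
Let t : R := 2 * tilt / eta.
Let grid_err : R := expR (11 / 10 * ((expR t - 1) * (1 + rmax *+ 2) ^+ d)).
Let err : R := 2 ^+ d * (grid_err + 1).

Let expR_eta : expR eta = 11 / 10.
Proof. by rewrite lnK// posrE; lra. Qed.

Let eta0 : 0 < eta.
Proof. by rewrite ln_gt0//; lra. Qed.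

Let vmin0 : 0 < vmin.
Proof. by rewrite mulr_gt0 ?unit_ball_vol_gt0// exprn_gt0. Qed.

Let tilt0 : 0 < tilt.
Proof. by rewrite divr_gt0. Qed.

Variables (n : nat) (r : R) (corner : 'I_(2 ^ d * n) -> nat -> R).
Let l : R := ln n%:R.
Let s : R := l `^ (2 / d%:R).
Hypotheses (n0 : (0 < n)%N) (rmin_r : rmin <= r) (r_rmax : r <= rmax).
Hypotheses (l1 : 1 <= l) (l_large : 1331 / 1000 * tilt * vmax <= eta * l).
Hypothesis (s_large : (s + rmax *+ 2) ^+ d <= 11 / 10 * l ^+ 2).

Let good k (x : nat -> R) : bool := [forall i : 'I_(2 ^ d * n),
  (cube_degsum d n r (corner i) s k x)%:R <
    2 * unit_ball_vol R d * r ^+ d * l ^+ 2].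

Let L := side R d n.
Let v : R := unit_ball_vol R d * r ^+ d.

Let nR : 1 <= n%:R :> R.
Proof. by rewrite ler1n. Qed.

Let nR0 : 0 < n%:R :> R.
Proof. by rewrite ltr0n. Qed.

Let r0 : 0 < r.
Proof. exact: lt_le_trans rmin_r. Qed.

Let vmin_v : vmin <= v.
Proof.
rewrite ler_pM2l ?unit_ball_vol_gt0//.
by rewrite lerXn2r ?nnegrE ?(ltW r0) ?(ltW rmin0).
Qed.

Let v_vmax : v <= vmax.
Proof.
rewrite ler_pM2l ?unit_ball_vol_gt0// lerXn2r ?nnegrE ?(ltW r0)//.
exact: le_trans (ltW r0) _.
Qed.

Let v0 : 0 < v.
Proof. exact: lt_le_trans vmin_v. Qed.

Let expR_l2 : n%:R * expR (- (2 * l)) = n%:R^-1 :> R.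
Proof.
rewrite expRN mulr2n mulrDl mul1r expRD /l lnK ?posrE//.
by field; rewrite gt_eqF.
Qed.

Lemma card_grid_le : #|{ffun 'I_d -> 'I_(grid_size R d n)}|%:R <= 2 ^+ d * n%:R :> R.
Proof.
rewrite card_ffun !card_ord natrX -(side_exprn R n d0) -exprMn -/L.
have L0 : 0 < L by exact: side_gt0.
have L1 : 1 <= L.
  by rewrite -(@ler_pXn2r _ d)// ?nnegrE ?(ltW L0)// expr1n side_exprn.
rewrite lerXn2r ?nnegrE ?mulr_ge0 ?(ltW L0)// /grid_size -natr1.
have /andP[] := truncn_itv (ltW L0); rewrite -/L => H _; lra.
Qed.

(** Order [n] grid cubes meet the Markov factor [n^-2], while [(1 + X / n)^k] stays bounded because
    [k / n] does. *)
Lemma grid_term_le (k : nat) : k%:R <= 11 / 10 * n%:R :> R ->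
  #|{ffun 'I_d -> 'I_(grid_size R d n)}|%:R * (expR (- (2 * l)) *
    (n%:R + (expR t - 1) * (1 + r *+ 2) ^+ d) ^+ k) <=
  n%:R ^+ k * (2 ^+ d * grid_err / n%:R).
Proof.
move=> kn; pose X : R := (expR t - 1) * (1 + r *+ 2) ^+ d.
pose Y : R := (expR t - 1) * (1 + rmax *+ 2) ^+ d.
have t0 : 0 <= t by rewrite divr_ge0 ?(ltW eta0)// mulr_ge0// ltW.
have et : 0 <= expR t - 1 by rewrite subr_ge0 -[leLHS]expR0 ler_expR.
have r1 : 0 <= 1 + r *+ 2 by rewrite addr_ge0// mulrn_wge0// ltW.
have r2 : 1 + r *+ 2 <= 1 + rmax *+ 2 by rewrite lerD2l lerMn2r.
have X0 : 0 <= X by rewrite mulr_ge0// exprn_ge0.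
have XY : X <= Y.
  by rewrite ler_wpM2l// lerXn2r ?nnegrE// (le_trans r1).
have pow_le : (n%:R + X) ^+ k <= n%:R ^+ k * grid_err.
  have -> : n%:R + X = n%:R * (1 + X / n%:R) by field; rewrite gt_eqF.
  rewrite exprMn ler_wpM2l ?exprn_ge0//.
  apply: (@le_trans _ _ (expR (X / n%:R) ^+ k)).
    by rewrite lerXn2r ?nnegrE ?expR_ge0 ?expR_ge1Dx// addr_ge0// divr_ge0.
  rewrite -expRM_natl ler_expR mulrCA mulrC -/Y.
  have kn' : k%:R / n%:R <= 11 / 10 :> R by rewrite ler_pdivrMr.
  by rewrite ler_pM// divr_ge0.
apply: (@le_trans _ _ (2 ^+ d * n%:R * (expR (- (2 * l)) * (n%:R ^+ k * grid_err)))).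
  rewrite ler_pM ?mulr_ge0 ?expR_ge0 ?exprn_ge0 ?addr_ge0 ?card_grid_le//.
  by rewrite ler_wpM2l ?expR_ge0.
have -> : 2 ^+ d * n%:R * (expR (- (2 * l)) * (n%:R ^+ k * grid_err)) =
  2 ^+ d * (n%:R * expR (- (2 * l))) * (n%:R ^+ k * grid_err) by ring.
rewrite expR_l2 le_eqVlt; apply/orP; left; apply/eqP; ring.
Qed.

Lemma cube_term_le (k : nat) (lam := tilt / l)
    (q := 11 / 10 * (lam * (11 / 10)) * v / n%:R) : k%:R <= 11 / 10 * n%:R :> R ->
  (2 ^ d * n)%:R * (expR (- (lam * (v * l ^+ 2))) * n%:R ^+ k *
    expR (11 / 10 * (s + r *+ 2) ^+ d / n%:R * (q * k%:R ^+ 2 / 2))) <=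
  n%:R ^+ k * (2 ^+ d / n%:R).
Proof.
move=> kn.
have l0 : 0 < l by apply: lt_le_trans l1.
have lamE : lam * (v * l ^+ 2) = tilt * v * l by rewrite /lam; field; rewrite gt_eqF.
pose y : R := k%:R / n%:R.
have y0 : 0 <= y by rewrite divr_ge0.
have y1 : y <= 11 / 10 by rewrite ler_pdivrMr.
have yy : y ^+ 2 <= 121 / 100 by nra.
have s0 : 0 <= s by exact: powR_ge0.
have r20 : 0 <= r *+ 2 by rewrite mulrn_wge0// ltW.
pose S := (s + r *+ 2) ^+ d.
have S0 : 0 <= S by rewrite exprn_ge0// addr_ge0.
have S1 : S <= 11 / 10 * l ^+ 2.
  have rm0 : 0 <= rmax *+ 2 by rewrite mulrn_wge0// (le_trans (ltW r0)).
  have sr : s + r *+ 2 <= s + rmax *+ 2 by rewrite lerD2l lerMn2r.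
  apply: le_trans s_large; apply: lerXn2r => //; rewrite nnegrE.
    exact: addr_ge0.
  exact: addr_ge0.
have Sy : S * y ^+ 2 <= 11 / 10 * l ^+ 2 * (121 / 100).
  by rewrite ler_pM// sqr_ge0.
have lv0 : 0 < lam * v by rewrite mulr_gt0// divr_gt0.
(* Six factors [11 / 10] arise: three are visible in the exponent and in [q], one comes from [S],
   two from [y ^ 2]. The bound works because [(11/10)^6 / 2 < 9/10]. *)
have exponent : 11 / 10 * S / n%:R * (q * k%:R ^+ 2 / 2) <= 9 / 10 * (tilt * v * l).
  have -> : 11 / 10 * S / n%:R * (q * k%:R ^+ 2 / 2) =
      1331 / 2000 * (lam * v * (S * y ^+ 2)).
    by rewrite /q /y; field; rewrite gt_eqF.
  have H : lam * v * (S * y ^+ 2) <= lam * v * (11 / 10 * l ^+ 2 * (121 / 100)).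
    by rewrite ler_pM2l.
  have E : lam * v * (11 / 10 * l ^+ 2 * (121 / 100)) = 1331 / 1000 * (tilt * v * l).
    by rewrite /lam; field; rewrite gt_eqF.
  have : 0 <= tilt * v * l by rewrite mulr_ge0 ?(ltW l0)// mulr_ge0 ?(ltW tilt0) ?(ltW v0).
  by move: H; rewrite E; lra.
(* The remaining tenth of the exponent is at least [2 * l], so each cube costs at most [n^-2]. *)
have tv : 20 * l <= tilt * v * l.
  rewrite ler_pM2r// /tilt mulrAC ler_pdivlMr//.
  by have := vmin_v; lra.
have -> : (2 ^ d * n)%:R * (expR (- (lam * (v * l ^+ 2))) * n%:R ^+ k *
    expR (11 / 10 * S / n%:R * (q * k%:R ^+ 2 / 2))) =
  n%:R ^+ k * (2 ^+ d * (n%:R * (expR (- (lam * (v * l ^+ 2))) *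
    expR (11 / 10 * S / n%:R * (q * k%:R ^+ 2 / 2))))).
  by rewrite natrM natrX; ring.
rewrite ler_wpM2l ?exprn_ge0// ler_wpM2l ?exprn_ge0// -[leRHS]expR_l2 ler_wpM2l//.
by rewrite -expRD ler_expR lamE; lra.
Qed.

Lemma iint_good_few_points (k : nat) : k%:R <= 11 / 10 * n%:R :> R ->
  ((n%:R ^+ k)%:E <= iint (- L / 2) (L / 2) (k * d) (fun x => (good k x)%:R%:E) +
    (n%:R ^+ k * (err / n%:R))%:E)%E.
Proof.
move=> kn; have l0 : 0 < l by apply: lt_le_trans l1.
have L0 : 0 < L by exact: side_gt0.
(* Now [lam * D = eta], so the truncation factor [expR (lam * D)] is exactly [11 / 10]. *)
pose D := eta / tilt * l; pose lam := tilt / l.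
have D0 : 0 <= D by rewrite mulr_ge0 ?(ltW l0)// divr_ge0 ?(ltW tilt0) ?(ltW eta0).
have t0 : 0 <= t by rewrite divr_ge0 ?(ltW eta0)// mulr_ge0// ltW.
have lam0 : 0 <= lam by rewrite divr_ge0 ?(ltW tilt0) ?(ltW l0).
have lamD : lam * D = eta by rewrite /lam /D; field; rewrite !gt_eqF.
have tD : t * D = 2 * l by rewrite /t /D; field; rewrite !gt_eqF.
have s0 : 0 <= s by exact: powR_ge0.
have Q : expR eta * (lam * expR (lam * D)) * (unit_ball_vol R d * r ^+ d) / L ^+ d * k%:R <= eta.
  rewrite side_exprn// lamD expR_eta -/v.
  have y1 : k%:R / n%:R <= 11 / 10 :> R by rewrite ler_pdivrMr.
  have y0 : 0 <= k%:R / n%:R :> R by rewrite divr_ge0.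
  (* [121 / 100] is [expR eta * expR (lam * D)]; one more [11 / 10] from [k / n] gives the
     [1331 / 1000] of [l_large]. *)
  have -> : 11 / 10 * (lam * (11 / 10)) * v / n%:R * k%:R =
    121 / 100 * (tilt * (v * (k%:R / n%:R))) / l.
    by rewrite /lam; field; rewrite !gt_eqF.
  rewrite ler_pdivrMr//; apply: le_trans l_large.
  have H : v * (k%:R / n%:R) <= vmax * (11 / 10) by rewrite ler_pM// ltW.
  have : tilt * (v * (k%:R / n%:R)) <= tilt * (vmax * (11 / 10)) by rewrite ler_pM2l.
  by lra.
have := @iint_good_ge R d n k L0 (2 ^ d * n) corner s r D t lam eta (v * l ^+ 2)
  s0 r0 D0 t0 lam0 d0 Q.
rewrite side_exprn// lamD expR_eta tD => H.
apply: le_trans H _; apply: leeD.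
  apply: le_iint => [x|x _]; first by rewrite lee_fin.
  by rewrite lee_fin ler_nat /good /v !mulrA.
rewrite lee_fin /err.
have -> : n%:R ^+ k * (2 ^+ d * (grid_err + 1) / n%:R) =
  n%:R ^+ k * (2 ^+ d * grid_err / n%:R) + n%:R ^+ k * (2 ^+ d / n%:R) by ring.
by apply: lerD; [exact: grid_term_le|exact: cube_term_le].
Qed.

Let tau : R := eta / 2.

(** For [k > 11 / 10 * n] the added exponential exceeds [1] and the bound is trivial; averaging this
    term over [k] gives the Chernoff bound for the Poisson tail. *)
Lemma iint_good_ge_all (k : nat) :
  ((n%:R ^+ k)%:E <= iint (- L / 2) (L / 2) (k * d) (fun x => (good k x)%:R%:E) +
    (n%:R ^+ k * (err / n%:R + expR (k%:R * tau - 11 / 10 * tau * n%:R)))%:E)%E.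
Proof.
have err0 : 0 <= err by rewrite mulr_ge0 ?exprn_ge0// addr_ge0// expR_ge0.
have [kn|kn] := leP (k%:R : R) (11 / 10 * n%:R).
  apply: le_trans (iint_good_few_points kn) _; rewrite leeD2l// lee_fin.
  by rewrite ler_wpM2l ?exprn_ge0// lerDl expR_ge0.
rewrite -[leLHS]add0e leeD ?iint_ge0//.
rewrite lee_fin -[leLHS]mulr1 ler_wpM2l ?exprn_ge0//.
rewrite -[leLHS]add0r lerD// ?divr_ge0// -[leLHS]expR0 ler_expR.
have tau0 : 0 < tau by rewrite divr_gt0.
rewrite mulrAC subr_ge0 ler_pM2r//; exact: ltW.
Qed.

(** The Chernoff rate: a Poisson variable of mean [n] exceeds [11 / 10 * n] with probability at most
    [expR (- (theta * n))]. *)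
Let theta : R := 1 + 11 / 10 * tau - expR tau.

Let theta0 : 0 < theta.
Proof.
have tau0 : 0 < tau by rewrite divr_gt0.
have : expR tau < 11 / 10 by rewrite -expR_eta ltr_expR /tau; have := eta0; lra.
have := expR_le1DM tau; rewrite /theta => H1 H2.
have : tau * expR tau < tau * (11 / 10) by rewrite ltr_pM2l.
by lra.
Qed.

Lemma poisson_weights_sum :
  (\sum_(k <oo) ((expR (- n%:R) * (n%:R ^+ k / k`!%:R))%R : R)%:E = 1)%E.
Proof. by rewrite nneseries_expR ?expR_ge0// -expRD addNr expR0. Qed.

(** Averaging [iint_good_ge_all] with the Poisson weights splits into the wanted probability,
    [err / n], and the Chernoff term, itself at most [1 / (theta * n)]. *)
Lemma PPP_prob_good_ge : ((1 - (err + theta^-1) / n%:R)%:E <= PPP_prob d n good)%E.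
Proof.
have err0 : 0 <= err by rewrite mulr_ge0 ?exprn_ge0// addr_ge0// expR_ge0.
pose p (k : nat) : R := expR (- n%:R) / k`!%:R.
have p0 k : 0 <= p k by rewrite divr_ge0// expR_ge0.
pose I (k : nat) := iint (- L / 2) (L / 2) (k * d) (fun x => (good k x)%:R%:E).
have I0 k : (0 <= I k)%E by apply: iint_ge0 => x; rewrite lee_fin.
pose c := expR (- n%:R) * expR (- (11 / 10 * tau * n%:R)).
have c0 : 0 <= c by rewrite mulr_ge0 ?expR_ge0.
have : (1 <= \sum_(k <oo) ((p k)%:E * I k +
    ((expR (- n%:R) * (err / n%:R) * (n%:R ^+ k / k`!%:R))%:E +
     (c * ((n%:R * expR tau) ^+ k / k`!%:R))%:E)))%E.
  rewrite -[X in (X <= _)%E]poisson_weights_sum; apply: lee_nneseries => k _.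
    by rewrite lee_fin mulr_ge0 ?expR_ge0// divr_ge0// exprn_ge0.
  have pk : (0 <= (p k)%:E)%E by rewrite lee_fin.
  have := lee_wpmul2l pk (iint_good_ge_all k).
  rewrite ge0_muleDr ?(I0 k)//; last first.
    by rewrite lee_fin mulr_ge0 ?exprn_ge0// addr_ge0 ?divr_ge0 ?expR_ge0.
  rewrite -EFinM -EFinM => H.
  have -> : expR (- n%:R) * (n%:R ^+ k / k`!%:R) = p k * n%:R ^+ k.
    by rewrite /p mulrCA mulrC.
  apply: le_trans H _; rewrite leeD2l// -EFinD lee_fin le_eqVlt; apply/orP; left.
  apply/eqP; rewrite /p /c exprMn -expRM_natl expRD.
  by ring.
have A0 (k : nat) : 0 <= expR (- n%:R) * (err / n%:R) * (n%:R ^+ k / k`!%:R).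
  by rewrite mulr_ge0 ?(divr_ge0 (exprn_ge0 _ _))// mulr_ge0 ?expR_ge0// divr_ge0.
have B0 (k : nat) : 0 <= c * ((n%:R * expR tau) ^+ k / k`!%:R).
  by rewrite mulr_ge0// divr_ge0// exprn_ge0// mulr_ge0// expR_ge0.
rewrite nneseriesD; last 2 first.
- by move=> k _ _; rewrite mule_ge0// lee_fin.
- by move=> k _ _; rewrite adde_ge0// lee_fin.
rewrite nneseriesD; last 2 first.
- by move=> k _ _; rewrite lee_fin.
- by move=> k _ _; rewrite lee_fin.
rewrite !nneseries_expR ?(mulr_ge0 (expR_ge0 _)) ?divr_ge0 ?(mulr_ge0 _ (expR_ge0 _))//.
rewrite -EFinD -/(PPP_prob d n good) => H.
rewrite EFinB leeBlDr//; apply: le_trans H _; rewrite leeD2l// lee_fin.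
have -> : expR (- n%:R) * (err / n%:R) * expR n%:R = err / n%:R.
  by rewrite mulrAC -expRD addNr expR0 mul1r.
rewrite mulrDl lerD2l /c -!expRD.
have -> : - n%:R - 11 / 10 * tau * n%:R + n%:R * expR tau = - (theta * n%:R).
  by rewrite /theta; ring.
rewrite expRN -invfM lef_pV2 ?posrE ?expR_gt0 ?mulr_gt0//.
by have := expR_ge1Dx (theta * n%:R); lra.
Qed.

Lemma PPP_prob_le1 (E : nat -> (nat -> R) -> bool) : (PPP_prob d n E <= 1)%E.
Proof.
have L0 : 0 < L by exact: side_gt0.
rewrite -[X in (_ <= X)%E]poisson_weights_sum; apply: lee_nneseries => k _.
  by rewrite mule_ge0 ?lee_fin ?divr_ge0 ?expR_ge0 ?iint_ge0.
rewrite [leRHS](_ : _ = ((expR (- n%:R) / k`!%:R)%:E * (n%:R ^+ k)%:E)%E); last first.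
  by rewrite -EFinM; congr EFin; rewrite mulrCA mulrC.
rewrite lee_wpmul2l ?lee_fin ?divr_ge0 ?expR_ge0//.
apply: (@le_trans _ _ (iint (- L / 2) (L / 2) (k * d) (fun=> 1%:E))).
  by apply: le_iint => [x|x _]; rewrite lee_fin// lern1 leq_b1.
rewrite iint_cst ?torus_side_le// (torus_side_sub R d n) mul1r -(side_exprn R n d0).
by rewrite -exprM mulnC.
Qed.
End UniformBound.

(** * Convergence of the probability to one *)

Theorem lemma2p3 (R : realType) (d : nat) (rmin rmax : R) (r : nat -> R)
    (B : nat -> nat -> nat -> R) :
  (2 <= d)%N ->
  r_giant R d < rmin -> rmin <= rmax ->
  (forall n, rmin <= r n <= rmax) ->
  (* for n >= 4, the cubes B n i (i < 2^d n), with lower corners B n i and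
     side (log n)^(2/d), cover Lambda_n^(d) *)
  (forall n, (4 <= n)%N -> forall p : nat -> R, in_torus d n p ->
     exists2 i, (i < 2 ^ d * n)%N & in_cube d n (B n i) (ln n%:R `^ (2 / d%:R)) p) ->
  whp d (fun n k x =>
    [forall i : 'I_(2 ^ d * n),
      (cube_degsum d n (r n) (B n i) (ln n%:R `^ (2 / d%:R)) k x)%:R
        < 2 * unit_ball_vol R d * r n ^+ d * ln n%:R ^+ 2]).
Proof.
move=> d2 rg_rmin rmin_rmax r_itv _.
have d0 : (0 < d)%N by exact: leq_trans d2.
have rmin0 : 0 < rmin by exact: le_lt_trans (r_giant_ge0 R d) rg_rmin.
have rmax0 : 0 <= rmax by rewrite (le_trans (ltW rmin0)).
have eta0 : 0 < ln (11 / 10) :> R by rewrite ln_gt0//; lra.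
pose tilt : R := 20 / (unit_ball_vol R d * rmin ^+ d).
pose E n k (x : nat -> R) := [forall i : 'I_(2 ^ d * n),
  (cube_degsum d n (r n) (B n i) (ln n%:R `^ (2 / d%:R)) k x)%:R
    < 2 * unit_ball_vol R d * r n ^+ d * ln n%:R ^+ 2].
have [K KP] : exists K : R,
    \forall n \near \oo, ((1 - K / n%:R)%:E <= PPP_prob d n (E n) <= 1)%E.
  (* [K] is fixed before [n]: [err] and [theta] depend only on [d], [rmin] and [rmax]. *)
  eexists; near=> n.
  have n0 : (0 < n)%N by near: n; exact: nbhs_infty_gt.
  have /andP[r1 r2] := r_itv n.
  have l1 : 1 <= ln n%:R :> R by near: n; exact: ln_ge_near.
  rewrite PPP_prob_le1// andbT.
  apply: (@PPP_prob_good_ge R d rmin rmax d0 rmin0 n (r n) (fun i => B n i)) => //.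
    have : 1331 / 1000 * tilt * (unit_ball_vol R d * rmax ^+ d) / ln (11 / 10) <= ln n%:R.
      by near: n; exact: ln_ge_near.
    by rewrite ler_pdivrMr// (mulrC (ln n%:R)).
  have H : (rmax *+ 2 * d%:R / ln (11 / 10)) ^+ d <= ln n%:R :> R.
    by near: n; exact: ln_ge_near.
  have := enlarged_cube_le d0 eta0 rmax0 l1 H.
  by rewrite lnK// posrE; lra.
(* [harmonic n] is [1 / (n + 1)]; the factor [2] absorbs the shift, as [1 / n <= 2 / (n + 1)]. *)
pose f n : R := 1 - `|K| * 2 * harmonic n.
have f1 : (f n)%:E @[n --> \oo] --> 1%E.
  apply: cvg_EFin; first exact: nearW.
  rewrite /comp /= -[X in _ --> X]subr0 -(mulr0 (`|K| * 2)).
  by apply: cvgB; [exact: cvg_cst|apply: cvgMr; exact: cvg_harmonic].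
apply: (squeeze_cvge _ f1 (cvg_cst 1%E)); near=> n.
have /andP[Kn ->] : ((1 - K / n%:R)%:E <= PPP_prob d n (E n) <= 1)%E by near: n.
rewrite andbT; apply: le_trans Kn; rewrite lee_fin lerD2l lerN2 /harmonic /=.
have n1 : 1 <= n%:R :> R by rewrite ler1n; near: n; exact: nbhs_infty_gt.
rewrite ler_pdivrMr; last lra.
have H : 1 <= 2 * n.+1%:R^-1 * n%:R :> R.
  by rewrite mulrAC ler_pdivlMr ?ltr0Sn// mul1r -(natr1 n); lra.
by apply: le_trans (ler_norm K) _; rewrite -[leLHS]mulr1 -!(mulrA `|K|) ler_wpM2l.
Unshelve. all: by end_near. Qed.
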